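(* Let $\varrho_n\to0$ with $n\varrho_n^{1/(2s)}\to\infty$. If $X_1,\dots,X_n$ are i.i.d. from $P_0$, then $$v_n^{-1/2}\big[n\,\eta^2_{\varrho_n}(\widehat P_n,P_0)-A_n\big]\xrightarrow{d}N(0,2),$$ where $v_n=\sum_{k\ge1}\big(\frac{\lambda_k}{\lambda_k+\varrho_n^2}\big)^2$ and $A_n=\frac1n\sum_{i=1}^n\tilde K_{\varrho_n}(X_i,X_i)$.
   Context: Standing setup. $(\mathcal X,\mathcal B)$ is a measurable space and $P_0$ a known probability measure on it. $K$ is a symmetric, positive semidefinite, square-integrable kernel, degenerate under $P_0$ ($\mathbb E_{P_0}K(X,\cdot)=0$), with Mercer decomposition $K(x,x')=\sum_{k\ge1}\lambda_k\varphi_k(x)\varphi_k(x')$, infinitely many eigenvalues $\lambda_1>\lambda_2>\cdots>0$, $\{\varphi_k\}$ an orthonormal basis of the $P_0$-mean-zero functions in $L_2(P_0)$, $0<\liminf_k k^{2s}\lambda_k\le\limsup_k k^{2s}\lambda_k<\infty$ for some $s>1/2$, and $\sup_k\|\varphi_k\|_\infty<\infty$. For $\varrho>0$, $\tilde K_\varrho(x,x')=\sum_{k\ge1}\frac{\lambda_k}{\lambda_k+\varrho^2}\varphi_k(x)\varphi_k(x')$, and the moderated MMD statistic is $\eta^2_{\varrho}(\widehat P_n,P_0)=\sum_{k\ge1}\frac{\lambda_k}{\lambda_k+\varrho^2}\big[\frac1n\sum_{i=1}^n\varphi_k(X_i)\big]^2$, where $\widehat P_n$ is the empirical distribution of $X_1,\dots,X_n$.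 *)

(* Defs.v *)
From HB Require Import structures.
From mathcomp Require Import all_boot all_order all_algebra.
From mathcomp Require Import all_classical all_reals all_analysis.
Set Implicit Arguments. Unset Strict Implicit. Unset Printing Implicit Defensive.
Import Order.TTheory GRing.Theory Num.Theory.
Import numFieldNormedType.Exports.
Local Open Scope classical_set_scope.
Local Open Scope ring_scope.

Section mmd.
Context {R : realType}.

(* moderation weight  lambda_k / (lambda_k + rho^2)  (index k : nat stands for k+1) *)
Definition mweight (lam : nat -> R) (rho : R) (k : nat) : R :=
  lam k / (lam k + rho ^+ 2).

Definition Ktilde {T : Type} (lam : nat -> R) (phi : nat -> T -> R) (rho : R)
  (x x' : T) : R :=
  limn (fun N => \sum_(0 <= k < N) (mweight lam rho k * phi k x * phi k x')).

Definition eta2 {T : Type} (lam : nat -> R) (phi : nat -> T -> R) (rho : R)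
  (n : nat) (xs : nat -> T) : R :=
  limn (fun N => \sum_(0 <= k < N)
     (mweight lam rho k * ((n%:R)^-1 * \sum_(i < n) phi k (xs i)) ^+ 2)).

Definition vn (lam : nat -> R) (rho : R) : R :=
  limn (fun N => \sum_(0 <= k < N) (mweight lam rho k ^+ 2)).

Definition An {T : Type} (lam : nat -> R) (phi : nat -> T -> R) (rho : R)
  (n : nat) (xs : nat -> T) : R :=
  (n%:R)^-1 * \sum_(i < n) Ktilde lam phi rho (xs i) (xs i).

Definition onb_mean_zero {d} {T : measurableType d} (P0 : probability T R)
  (phi : nat -> T -> R) : Prop :=
  [/\ (forall k, measurable_fun setT (phi k)),
      (forall k, P0.-integrable setT (fun x => (phi k x ^+ 2)%:E)),
      (forall k, (\int[P0]_x (phi k x)%:E = 0)%E),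
      (forall j k, (\int[P0]_x (phi j x * phi k x)%:E = ((j == k)%:R)%:E)%E) &
      (forall f : T -> R, measurable_fun setT f ->
         P0.-integrable setT (fun x => (f x ^+ 2)%:E) ->
         (\int[P0]_x (f x)%:E = 0)%E ->
         (forall k, (\int[P0]_x (f x * phi k x)%:E = 0)%E) ->
         {ae P0, forall x, f x = 0})].

Definition iid {dO d} {Omega : measurableType dO} {T : measurableType d}
  (P : probability Omega R) (P0 : probability T R) (X : nat -> Omega -> T) : Prop :=
  [/\ (forall i, measurable_fun setT (X i)),
      (forall i (A : set T), measurable A -> P (X i @^-1` A) = P0 A) &
      (forall (s : seq nat) (A : nat -> set T), uniq s ->
         (forall i, measurable (A i)) ->
         fine (P (\bigcap_(i in [set i | i \in s]) (X i @^-1` A i)))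
         = \prod_(i <- s) fine (P (X i @^-1` A i)))].

End mmd.

(* Main.v *)
(** The statistic is [W = c \sum_(i != j) H(X_i, X_j)], [c = 1 / (n sqrt v)], with
    the degenerate kernel [H(x, y) = \sum_k w_k phi_k(x) phi_k(y)].  Removing the index [i] changes [W]
    by [2 c Y_i], where [Y_i = \sum_(j != i) H(X_i, X_j)] has mean zero given the
    other variables, so that [E (W f(W)) = c \sum_i E (Y_i (f(W) - f(W - 2 c Y_i)))]
    is close to [2 c^2 \sum_i E (Y_i^2) E (f'(W))], i.e. to [2 E (f'(W))].
    The error is controlled by the fourth moments of the [Y_i] and the variance of
    [\sum_k w_k^2 (\sum_j phi_k(X_j))^2], and is governed by
    [1/n + 1/v + L^2/(n^2 v)] with [L = \sum_k w_k]; the decay of the eigenvalues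
    makes [L] and [v] of order [rho^(-1/s)], so this tends to zero.  Solving Stein's
    equation [2 f' - x f = psi] for compactly supported [psi] then identifies the
    limit.  The moment computations are done for the kernel truncated at [N] terms,
    and [N] is sent to infinity by dominated convergence. *)

Require Import Defs.
From HB Require Import structures.
From mathcomp Require Import all_boot all_order all_algebra.
From mathcomp Require Import all_classical all_reals all_analysis.
From mathcomp Require Import measurable_realfun.
From mathcomp Require Import ring lra.
Set Implicit Arguments. Unset Strict Implicit. Unset Printing Implicit Defensive.
Import Order.TTheory GRing.Theory Num.Theory.
Import numFieldNormedType.Exports.
Local Open Scope classical_set_scope.
Local Open Scope ring_scope.

(** Conditional expectations are avoided: [X i] is independent of the sigma-algebra generated by the
    other observations, and a product rule for expectations takes the place of conditioning.
    Truncating the kernel makes every variable bounded, so integrability is automatic in the moment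
    computations. Polynomial inequalities replace Cauchy-Schwarz, at the price of a free parameter
    [a] that is fixed only at the very end.

    Taking [psi] with compact support and zero Gaussian mean makes the Stein solution vanish off the
    same interval, so its bounds require no Gaussian tail estimates. The obstacle is that centring a
    bump function by a constant destroys its compact support. Two bumps [g] and [chi], with Gaussian
    means [Ng] and [Nc], are therefore compared through [Nc * g - Ng * chi], which is centred and
    compactly supported at once. The second moment bound [E W^2 <= 2] shows that no mass escapes:
    [E chi] is close to one when [chi] has a wide plateau. *)

(** * Independence of one observation from the sigma-algebra of the others *)

Section independence.
Context {R : realType} {dO d : measure_display} {Omega : measurableType dO}
  {T : measurableType d} (P : probability Omega R) (P0 : probability T R)
  (X : nat -> Omega -> T).

(* A pi-system generating the sigma-algebra of the [X j], [j < n], [j <> i]. *)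
Definition cyl_others (n i : nat) : set_system Omega :=
  [set B | exists A : nat -> set T, [/\ forall j, measurable (A j), A i = setT &
    B = \bigcap_(j in [set j | j \in iota 0 n]) (X j @^-1` A j)]].

Definition others (n i : nat) (Z : Omega -> R) : Prop :=
  @measurable_fun _ _ (g_sigma_algebraType (cyl_others n i)) R setT Z.

Hypothesis XI : iid P P0 X.

Lemma iid_measurable i : measurable_fun setT (X i).
Proof. by have [+ _ _] := XI; exact. Qed.

Lemma cyl_others_measurable n i : cyl_others n i `<=` measurable.
Proof.
move=> _ [A [mA _ ->]]; apply: fin_bigcap_measurable.
  exact: finite_seq.
move=> j _; rewrite -[X in measurable X]setTI; exact: iid_measurable.
Qed.

Lemma cyl_othersI n i : setI_closed (cyl_others n i).
Proof.
move=> _ _ [A [mA Ai ->]] [B [mB Bi ->]]; exists (fun j => A j `&` B j); split.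
- by move=> j; apply: measurableI.
- by rewrite Ai Bi setTI.
- by rewrite -bigcapI; apply: eq_bigcapr => j _; rewrite preimage_setI.
Qed.

Lemma cyl_others_setT n i : cyl_others n i setT.
Proof.
exists (fun=> setT); split => //; by apply/esym; rewrite -subTset => x _ j _.
Qed.

Lemma cyl_others_indep n i A B : (i < n)%N -> measurable A -> cyl_others n i B ->
  P (X i @^-1` A `&` B) = (P0 A * P B)%E.
Proof.
move=> ltin mA [A' [mA' A'i ->]].
have [_ XP0 Xind] := XI.
(* Since [A' i = setT], the set [A] fits into the free slot [i]; both events are then cylinders over
   all of [iota 0 n], and the two products differ in one factor only. *)
pose A'' j := if j == i then A else A' j.
have mA'' j : measurable (A'' j) by rewrite /A''; case: ifP.
have in_i : i \in iota 0 n by rewrite mem_iota.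
have -> : X i @^-1` A `&` \bigcap_(j in [set j | j \in iota 0 n]) (X j @^-1` A' j)
  = \bigcap_(j in [set j | j \in iota 0 n]) (X j @^-1` A'' j).
  apply/seteqP; split => w.
    by move=> [wA wA'] j jn; rewrite /A'' /preimage /=; case: eqP => [->|_] //; exact: wA'.
  move=> wA; split; first by have := wA i in_i; rewrite /A'' /preimage /= eqxx.
  move=> j jn; have := wA j jn; rewrite /A'' /preimage /=; case: eqP => [->|//].
  by rewrite A'i.
have mcap (C : nat -> set T) : (forall j, measurable (C j)) ->
    measurable (\bigcap_(j in [set j | j \in iota 0 n]) (X j @^-1` C j)).
  move=> mC; apply: fin_bigcap_measurable; first exact: finite_seq.
  move=> j _; rewrite -[X in measurable X]setTI; exact: iid_measurable.
have fP (C : set Omega) : measurable C -> P C = (fine (P C))%:E.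
  by move=> mC; rewrite fineK// fin_num_measure.
rewrite (fP _ (mcap _ mA'')) (fP _ (mcap _ mA')) !Xind ?iota_uniq//.
rewrite -[P0 A]fineK ?fin_num_measure// -EFinM; congr EFin.
rewrite !(big_rem i in_i)/= {1}/A'' eqxx XP0// A'i XP0// probability_setT mul1r.
congr (_ * _); rewrite !big_seq; apply: eq_bigr => j.
by rewrite (rem_filter _ (iota_uniq _ _)) mem_filter /A'' => /andP[/= /negbTE ->].
Qed.

Lemma sigma_others_indep n i A B : (i < n)%N -> measurable A ->
  <<s cyl_others n i >> B -> P (X i @^-1` A `&` B) = (P0 A * P B)%E.
Proof.
move=> ltin mA; have mXA : measurable (X i @^-1` A).
  by rewrite -[X in measurable X]setTI; exact: iid_measurable.
have P0A : (0 <= fine (P0 A))%R by rewrite fine_ge0.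
pose m1 := mrestr P mXA; pose m2 := mscale (NngNum P0A) P.
have E2 C : m2 C = (P0 A * P C)%E by rewrite /m2 /mscale/= fineK ?fin_num_measure.
have E1 C : m1 C = P (X i @^-1` A `&` C) by rewrite /m1 /mrestr setIC.
rewrite -E1 -E2.
apply: (g_sigma_algebra_measure_unique _ (@cyl_others_measurable n i) (fun=> setT)).
- by move=> _; exact: cyl_others_setT.
- by rewrite bigcup_const//; exists 0%N.
- exact: cyl_othersI.
- by move=> C CC; change (m1 C = m2 C); rewrite E1 E2 (@cyl_others_indep n).
- move=> _; change (m1 setT < +oo)%E; rewrite E1 setIT.
  exact: le_lt_trans (probability_le1 _ mXA) (ltry _).
Qed.


Lemma othersP n i Z B : others n i Z -> measurable B ->
  <<s cyl_others n i >> (Z @^-1` B).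
Proof. by move=> mZ mB; rewrite -[X in <<s _ >> X]setTI; exact: mZ. Qed.

Lemma others_measurable n i Z : others n i Z -> measurable_fun setT Z.
Proof.
move=> mZ _ B mB; rewrite setTI.
have := othersP mZ mB; apply: smallest_sub; last exact: cyl_others_measurable.
exact: sigma_algebra_measurable.
Qed.

Lemma others_comp n i j (u : T -> R) : measurable_fun setT u -> (j < n)%N ->
  j != i -> others n i (u \o X j).
Proof.
move=> mu jn ji _ B mB; rewrite setTI; apply: sub_sigma_algebra.
exists (fun k => if k == j then u @^-1` B else setT); split.
- by move=> k; case: ifP => // _; rewrite -[X in measurable X]setTI; exact: mu.
- by rewrite eq_sym (negbTE ji).
- apply/seteqP; split => w /=.
    by move=> wB k _; case: eqP => [->|//].
  by move=> /(_ j); rewrite eqxx; apply; rewrite /= mem_iota.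
Qed.

(** The joint law of [X i] and [Z] is the product of [P0] and the law of [Z], because the two agree
    on rectangles; Tonelli then separates the integrals. *)
Lemma ge0_expect_mul n i (u : T -> R) (Z : Omega -> R) : (i < n)%N ->
  measurable_fun setT u -> others n i Z -> (forall x, 0 <= u x) ->
  (forall w, 0 <= Z w) ->
  (\int[P]_w (u (X i w) * Z w)%:E = \int[P0]_x (u x)%:E * \int[P]_w (Z w)%:E)%E.
Proof.
move=> ltin mu oZ u0 Z0; have mZ := others_measurable oZ.
have mX := iid_measurable i.
pose TR : measurableType _ := (T * R)%type.
pose XZ w : TR := (X i w, Z w).
have mXZ : measurable_fun setT XZ by apply/measurable_fun_pair.
pose Zm : {mfun Omega >-> R} := HB.pack Z (isMeasurableFun.Build _ _ _ _ _ mZ).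
pose XZm : {mfun Omega >-> TR} :=
  HB.pack XZ (isMeasurableFun.Build _ _ _ _ _ mXZ).
pose PZ := distribution P Zm.
pose PXZ := distribution P XZm.
have prodE : forall C, measurable C -> (P0 \x PZ)%E C = PXZ C.
  apply: product_measure_unique => A B mA mB.
  by apply: (sigma_others_indep ltin) => //; exact: (othersP oZ).
(* The absolute value makes the integrand nonnegative on the whole product space, and changes
   nothing along [Z], which is nonnegative. *)
pose f (z : TR) : \bar R := (u z.1 * `|z.2|)%:E.
have mf : measurable_fun setT f.
  apply/measurable_EFinP; apply: measurable_funM.
    by apply: measurableT_comp.
  by apply: measurableT_comp.
have f0 z : (0 <= f z)%E by rewrite lee_fin mulr_ge0.
transitivity (\int[PXZ]_z f z)%E.
  rewrite ge0_integral_pushforward//.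
  by apply: eq_integral => w _ /=; rewrite /f /= ger0_norm.
transitivity (\int[(P0 \x PZ)%E]_z f z)%E.
  by apply: eq_measure_integral => C mC _; exact/esym/prodE.
rewrite fubini_tonelli1//.
transitivity (\int[P0]_x ((u x)%:E * \int[PZ]_y `|y|%:E))%E.
  apply: eq_integral => x _; rewrite /fubini_F /f /=.
  under eq_integral do rewrite EFinM.
  by rewrite ge0_integralZl//; [exact/measurable_EFinP|rewrite lee_fin].
rewrite ge0_integralZr//; [|exact/measurable_EFinP| |exact: integral_ge0].
- congr (_ * _)%E; rewrite ge0_integral_pushforward//=.
    by apply: eq_integral => w _ /=; rewrite ger0_norm.
  exact/measurable_EFinP.
- by move=> x _; rewrite lee_fin.
Qed.

End independence.

(** * Bounded measurable functions and their expectations *)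

(** A class closed under ring operations and contained in [L1] of every probability measure, so that
    integrability side conditions reduce to the shape of the expression. *)
Definition bmeas {R : realType} {d} {T : measurableType d} (Z : T -> R) : Prop :=
  measurable_fun setT Z /\ exists K, forall w, `|Z w| <= K.

Section bmeas_closure.
Context {R : realType} {d : measure_display} {T : measurableType d}.
Implicit Types Z : T -> R.

Lemma bmeas_cst (r : R) : bmeas (fun _ : T => r).
Proof. by split => //; exists `|r|. Qed.

Lemma bmeasD Z1 Z2 : bmeas Z1 -> bmeas Z2 -> bmeas (fun w => Z1 w + Z2 w).
Proof.
move=> [m1 [K1 b1]] [m2 [K2 b2]]; split; first exact: measurable_funD.
by exists (K1 + K2) => w; rewrite (le_trans (ler_normD _ _))// lerD.
Qed.

Lemma bmeasM Z1 Z2 : bmeas Z1 -> bmeas Z2 -> bmeas (fun w => Z1 w * Z2 w).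
Proof.
move=> [m1 [K1 b1]] [m2 [K2 b2]]; split; first exact: measurable_funM.
by exists (K1 * K2) => w; rewrite normrM ler_pM.
Qed.

Lemma bmeasN Z : bmeas Z -> bmeas (fun w => - Z w).
Proof.
move=> [m1 [K1 b1]]; split; first exact: measurable_funN.
by exists K1 => w; rewrite normrN.
Qed.

Lemma bmeasB Z1 Z2 : bmeas Z1 -> bmeas Z2 -> bmeas (fun w => Z1 w - Z2 w).
Proof. by move=> b1 b2; apply: bmeasD => //; exact: bmeasN. Qed.

Lemma bmeasX Z n : bmeas Z -> bmeas (fun w => Z w ^+ n).
Proof.
move=> [m1 [K1 b1]]; split; first exact: measurable_funX.
by exists (K1 ^+ n) => w; rewrite normrX lerXn2r// nnegrE (le_trans _ (b1 w)).
Qed.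

Lemma bmeas_norm Z : bmeas Z -> bmeas (fun w => `|Z w|).
Proof.
move=> [m1 [K1 b1]]; split; first exact: measurableT_comp.
by exists K1 => w; rewrite normr_id.
Qed.

Lemma bmeas_sum I (s : seq I) (Z : I -> T -> R) : (forall i, bmeas (Z i)) ->
  bmeas (fun w => \sum_(i <- s) Z i w).
Proof.
move=> bZ; elim: s => [|i s IH].
  by under eq_fun do rewrite big_nil; exact: bmeas_cst.
by under eq_fun do rewrite big_cons; exact: bmeasD.
Qed.

Lemma bmeas_sum_seq (I : eqType) (s : seq I) (Z : I -> T -> R) :
  {in s, forall i, bmeas (Z i)} -> bmeas (fun w => \sum_(i <- s) Z i w).
Proof.
elim: s => [|i s IH] bZ.
  by under eq_fun do rewrite big_nil; exact: bmeas_cst.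
under eq_fun do rewrite big_cons; apply: bmeasD; first by apply: bZ; rewrite inE eqxx.
by apply: IH => j js; apply: bZ; rewrite inE js orbT.
Qed.

Lemma bmeas_comp (f : R -> R) Z K : measurable_fun setT f ->
  (forall x, `|f x| <= K) -> measurable_fun setT Z -> bmeas (fun w => f (Z w)).
Proof. by move=> mf fK mZ; split; [exact: measurableT_comp|exists K]. Qed.

End bmeas_closure.

Ltac bm := repeat first [exact: bmeas_cst | solve [auto] | apply: bmeasB | apply: bmeasD
  | apply: bmeasN | apply: bmeasM | apply: bmeasX | apply: bmeas_norm | apply: bmeas_sum => ?].

Section expectation.
Context {R : realType} {d : measure_display} {T : measurableType d}
  (P : probability T R).
Implicit Types Z : T -> R.
Local Notation E := (Rintegral P setT).

Lemma bmeas_integrable Z : bmeas Z -> P.-integrable setT (EFin \o Z).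
Proof.
move=> [mZ [K bK]]; apply: measurable_bounded_integrable => //.
  by rewrite [X in (X < _)%E]probability_setT ltry.
exists K; split; first exact: num_real.
  move=> x Kx w _ /=; exact: le_trans (bK w) (ltW Kx).
Qed.

Lemma ex_cst (r : R) : E (fun=> r) = r.
Proof. by rewrite Rintegral_cst// [X in fine X]probability_setT mulr1. Qed.

Lemma exD Z1 Z2 : bmeas Z1 -> bmeas Z2 -> E (fun w => Z1 w + Z2 w) = E Z1 + E Z2.
Proof. by move=> b1 b2; rewrite RintegralD//; exact: bmeas_integrable. Qed.

Lemma exB Z1 Z2 : bmeas Z1 -> bmeas Z2 -> E (fun w => Z1 w - Z2 w) = E Z1 - E Z2.
Proof. by move=> b1 b2; rewrite RintegralB//; exact: bmeas_integrable. Qed.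

Lemma exZ (r : R) Z : bmeas Z -> E (fun w => r * Z w) = r * E Z.
Proof. by move=> b1; rewrite RintegralZl//; exact: bmeas_integrable. Qed.

Lemma ex_sum (I : eqType) (s : seq I) (Z : I -> T -> R) :
  {in s, forall i, bmeas (Z i)} ->
  E (fun w => \sum_(i <- s) Z i w) = \sum_(i <- s) E (Z i).
Proof.
elim: s => [|i s IH] bZ.
  by under eq_Rintegral do rewrite big_nil; rewrite ex_cst big_nil.
have bs : {in s, forall i, bmeas (Z i)} by move=> j js; apply: bZ; rewrite inE js orbT.
under eq_Rintegral do rewrite big_cons.
rewrite exD; [|by apply: bZ; rewrite inE eqxx|exact: bmeas_sum_seq].
by rewrite IH// big_cons.
Qed.

Lemma ex_le Z1 Z2 : bmeas Z1 -> bmeas Z2 -> (forall w, Z1 w <= Z2 w) -> E Z1 <= E Z2.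
Proof. by move=> b1 b2 le12; apply: le_Rintegral => //; exact: bmeas_integrable. Qed.

Lemma ex_ge0 Z : (forall w, 0 <= Z w) -> 0 <= E Z.
Proof. by move=> Z0; exact: Rintegral_ge0. Qed.

Lemma ex_norm Z : bmeas Z -> `|E Z| <= E (fun w => `|Z w|).
Proof. by move=> bZ; apply: le_normr_Rintegral => //; exact: bmeas_integrable. Qed.

Lemma ex_ext Z1 Z2 : (forall w, Z1 w = Z2 w) -> E Z1 = E Z2.
Proof. by move=> e; apply: eq_Rintegral => w _. Qed.

Lemma ex_eq0 Z : (forall w, Z w = 0) -> E Z = 0.
Proof. by move=> Z0; rewrite -(ex_cst 0); exact: ex_ext. Qed.

Lemma ex_norm_le Z1 Z2 : bmeas Z1 -> bmeas Z2 -> (forall w, `|Z1 w| <= Z2 w) ->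
  `|E Z1| <= E Z2.
Proof.
move=> b1 b2 le12; apply: le_trans (ex_norm b1) _.
by apply: ex_le => //; exact: bmeas_norm.
Qed.

(** Stands in for Cauchy-Schwarz: pointwise, [a |z| <= a^2 + z^2]. The next lemma is the same
    inequality multiplied by [z^2]. *)
Lemma ex_norm_amgm (a : R) Z : 0 < a -> bmeas Z ->
  E (fun w => `|Z w|) <= a + E (fun w => Z w ^+ 2) / a.
Proof.
move=> a0 bZ.
rewrite -[a in a + _]ex_cst mulrC -exZ; last by bm.
rewrite -exD; [|by bm|by bm].
apply: ex_le; [by bm|by bm|move=> w].
rewrite -(ler_pM2l a0) mulrDr mulVKf ?gt_eqF// -[Z w ^+ 2]real_normK ?num_real//.
by have := sqr_ge0 (a - `|Z w|); have := normr_ge0 (Z w); nra.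
Qed.

Lemma ex_norm3_amgm (a : R) Z : 0 < a -> bmeas Z ->
  E (fun w => `|Z w| ^+ 3) <= a * E (fun w => Z w ^+ 2) + E (fun w => Z w ^+ 4) / a.
Proof.
move=> a0 bZ.
rewrite [X in _ + X]mulrC -!exZ; [|by bm|by bm].
rewrite -exD; [|by bm|by bm].
apply: ex_le; [by bm|by bm|move=> w].
rewrite -(ler_pM2l a0) mulrDr mulVKf ?gt_eqF//.
have -> : Z w ^+ 4 = `|Z w| ^+ 4 by rewrite (exprM _ 2 2) -[Z w ^+ 2]real_normK ?num_real// -exprM.
rewrite -[Z w ^+ 2]real_normK ?num_real//.
set z := `|Z w|; have z0 : 0 <= z by exact: normr_ge0.
have : 0 <= z ^+ 2 * (a - z) ^+ 2 by rewrite mulr_ge0// sqr_ge0.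
have : 0 <= a * z ^+ 3 by apply: mulr_ge0; [exact: ltW|exact: exprn_ge0].
by rewrite !exprS expr0; nra.
Qed.

End expectation.

(** * Product rule for expectations under independence *)

Section product_rule.
Context {R : realType} {dO d : measure_display} {Omega : measurableType dO}
  {T : measurableType d} (P : probability Omega R) (P0 : probability T R)
  (X : nat -> Omega -> T).
Hypothesis XI : iid P P0 X.
Local Notation E := (Rintegral P setT).
Local Notation E0 := (Rintegral P0 setT).

(** Only the sigma-algebra on [Omega] is exchanged, so all closure lemmas for [bmeas] apply to
    functions of the other observations. *)
Definition obmeas n i (Z : Omega -> R) :=
  @bmeas R _ (g_sigma_algebraType (cyl_others X n i)) Z.

Lemma obmeas_bmeas n i Z : obmeas n i Z -> bmeas Z.
Proof. by move=> [mZ bZ]; split => //; exact: (others_measurable XI mZ). Qed.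

Lemma bmeas_compX i (u : T -> R) : bmeas u -> bmeas (fun w => u (X i w)).
Proof.
move=> [mu [K bu]]; split; last by exists K.
by apply: measurableT_comp => //; exact: (iid_measurable XI).
Qed.

Lemma obmeas_compX n i j (u : T -> R) : bmeas u -> (j < n)%N -> j != i ->
  obmeas n i (fun w => u (X j w)).
Proof.
move=> [mu [K bu]] jn ji; split; last by exists K.
exact: (others_comp mu).
Qed.

Lemma ge0_ex_mul n i (u : T -> R) Z : (i < n)%N -> bmeas u -> obmeas n i Z ->
  (forall x, 0 <= u x) -> (forall w, 0 <= Z w) ->
  E (fun w => u (X i w) * Z w) = E0 u * E Z.
Proof.
move=> ltin bu oZ u0 Z0; rewrite /Rintegral.
rewrite (ge0_expect_mul XI ltin (proj1 bu) (proj1 oZ))// fineM//.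
  by apply: integrable_fin_num => //; exact: (bmeas_integrable _ bu).
by apply: integrable_fin_num => //; apply: (bmeas_integrable _ (obmeas_bmeas oZ)).
Qed.

(** Adding their bounds to [u] and [Z] makes both nonnegative; expanding the product of the shifted
    functions reduces the claim to [ge0_ex_mul]. *)
Lemma ex_mul n i (u : T -> R) Z : (i < n)%N -> bmeas u -> obmeas n i Z ->
  E (fun w => u (X i w) * Z w) = E0 u * E Z.
Proof.
move=> ltin bu oZ; have bZ := obmeas_bmeas oZ.
have [_ [K uK]] := bu; have [_ [L ZL]] := oZ.
pose u' x := u x + K; pose Z' w := Z w + L.
have u'0 x : 0 <= u' x by have := uK x; rewrite ler_norml /u' => /andP[? ?]; lra.
have Z'0 w : 0 <= Z' w by have := ZL w; rewrite ler_norml /Z' => /andP[? ?]; lra.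
have bu' : bmeas u' by rewrite /u'; bm.
have oc r : obmeas n i (fun=> r) by exact: bmeas_cst.
have oZ' : obmeas n i Z' := bmeasD oZ (oc L).
have bZ' : bmeas Z' := obmeas_bmeas oZ'.
have buX := bmeas_compX i bu; have bu'X := bmeas_compX i bu'.
have e1 := ge0_ex_mul ltin bu' oZ' u'0 Z'0.
have e2 := ge0_ex_mul ltin bu' (oc 1) u'0 (fun=> ler01).
have : E (fun w => u (X i w) * Z w) = E (fun w => u' (X i w) * Z' w)
    - L * E (fun w => u' (X i w) * 1) - K * E (fun w => Z w).
  rewrite -!exZ; [|by bm|by bm].
  rewrite -!exB; [|by bm|by bm|by bm|by bm].
  by apply: ex_ext => w; rewrite /u' /Z'; ring.
rewrite e1 e2 ex_cst => ->.
have -> : E0 u' = E0 u + K by rewrite exD ?ex_cst//; bm.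
have -> : E Z' = E Z + L by rewrite exD ?ex_cst//; bm.
by ring.
Qed.

End product_rule.

(** * Moments of the truncated degenerate quadratic form *)

Section moments.
Context {R : realType} {dO d : measure_display} {Omega : measurableType dO}
  {T : measurableType d} (P : probability Omega R) (P0 : probability T R)
  (X : nat -> Omega -> T) (phi : nat -> T -> R) (w : nat -> R) (M : R) (n N : nat).
Hypothesis XI : iid P P0 X.
Hypothesis w01 : forall k, 0 <= w k <= 1.
Hypothesis mphi : forall k, measurable_fun setT (phi k).
Hypothesis M1 : 1 <= M.
Hypothesis phiM : forall k x, `|phi k x| <= M.
Local Notation E := (Rintegral P setT).
Local Notation E0 := (Rintegral P0 setT).
Hypothesis phi0 : forall k, E0 (phi k) = 0.
Hypothesis phi_orth : forall j k, E0 (fun x => phi j x * phi k x) = (j == k)%:R.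

Definition Tsum (s : seq nat) k om := \sum_(j <- s) phi k (X j om).
(** The sum over [j] in [s] of the truncated kernel [H (X_i, X_j)], arranged as a linear form in the
    [phi k (X i)] whose coefficients involve only the variables of [s]. *)
Definition Ysum i (s : seq nat) om :=
  \sum_(0 <= k < N) phi k (X i om) * (w k * Tsum s k om).
(** For [i] outside [s] this is the conditional second moment of [Ysum i s] given the variables of
    [s]. *)
Definition Qsum (s : seq nat) om := \sum_(0 <= k < N) (w k * Tsum s k om) ^+ 2.
Definition vsum := \sum_(0 <= k < N) w k ^+ 2.
Definition Lsum := \sum_(0 <= k < N) w k.

Let w0 k : 0 <= w k. Proof. by have /andP[] := w01 k. Qed.
Let w1 k : w k <= 1. Proof. by have /andP[] := w01 k. Qed.
Let M0 : 0 <= M. Proof. exact: le_trans M1. Qed.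

Lemma vsum_ge0 : 0 <= vsum.
Proof. by apply: sumr_ge0 => k _; exact: sqr_ge0. Qed.

Lemma Lsum_ge0 : 0 <= Lsum.
Proof. by apply: sumr_ge0 => k _. Qed.

Lemma bmeas_phi k : bmeas (phi k).
Proof. by split => //; exists M. Qed.

Lemma bmeas_phiX k i : bmeas (fun om => phi k (X i om)).
Proof. exact: (bmeas_compX XI i (bmeas_phi k)). Qed.

Lemma bmeas_Tsum s k : bmeas (Tsum s k).
Proof. by apply: bmeas_sum => j; exact: bmeas_phiX. Qed.

Lemma bmeas_Ysum i s : bmeas (Ysum i s).
Proof.
apply: bmeas_sum => k; apply: bmeasM; first exact: bmeas_phiX.
by apply: bmeasM; [exact: bmeas_cst|exact: bmeas_Tsum].
Qed.

Lemma bmeas_Qsum s : bmeas (Qsum s).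
Proof.
apply: bmeas_sum => k; apply: bmeasX.
by apply: bmeasM; [exact: bmeas_cst|exact: bmeas_Tsum].
Qed.

Lemma obmeas_phiX k i j : (j < n)%N -> j != i ->
  obmeas X n i (fun om => phi k (X j om)).
Proof. by move=> jn ji; exact: (obmeas_compX X (bmeas_phi k)). Qed.

Lemma obmeas_Tsum i s k : {in s, forall j, (j < n)%N} -> i \notin s ->
  obmeas X n i (Tsum s k).
Proof.
move=> sn is_; apply: bmeas_sum_seq => j js; apply: obmeas_phiX; first exact: sn.
by apply: contraNneq is_ => <-.
Qed.

Lemma obmeas_wTsum i s k : {in s, forall j, (j < n)%N} -> i \notin s ->
  obmeas X n i (fun om => w k * Tsum s k om).
Proof. by move=> sn is_; apply: bmeasM; [exact: bmeas_cst|exact: obmeas_Tsum]. Qed.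

Lemma obmeas_Qsum i s : {in s, forall j, (j < n)%N} -> i \notin s ->
  obmeas X n i (Qsum s).
Proof.
by move=> sn is_; apply: bmeas_sum => k; apply: bmeasX; exact: obmeas_wTsum.
Qed.

Lemma obmeas_Ysum i j s : {in s, forall j, (j < n)%N} -> i \notin s ->
  (j < n)%N -> j != i -> obmeas X n i (Ysum j s).
Proof.
move=> sn is_ jn ji; apply: bmeas_sum => k; apply: bmeasM.
  exact: obmeas_phiX.
exact: obmeas_wTsum.
Qed.

Lemma ex_phiX_mul k i Z : (i < n)%N -> obmeas X n i Z ->
  E (fun om => phi k (X i om) * Z om) = 0.
Proof. by move=> ltin oZ; rewrite (ex_mul XI ltin (bmeas_phi k) oZ) phi0 mul0r. Qed.

(** Degeneracy: averaging over [X i] alone kills a linear form in the [phi k (X i)], whatever weight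
    [U] the other observations contribute. *)
Lemma ex_lin (Z : nat -> Omega -> R) U i : (i < n)%N ->
  (forall k, obmeas X n i (Z k)) -> obmeas X n i U ->
  E (fun om => (\sum_(0 <= k < N) phi k (X i om) * Z k om) * U om) = 0.
Proof.
move=> ltin oZ oU.
under ex_ext => om do rewrite big_distrl/=.
rewrite ex_sum => [|k _].
  rewrite big1 // => k _; under ex_ext => om do rewrite -mulrA.
  by apply: ex_phiX_mul => //; exact: bmeasM (oZ k) oU.
apply: bmeasM; last exact: (obmeas_bmeas XI oU).
by apply: bmeasM; [exact: bmeas_phiX|exact: (obmeas_bmeas XI (oZ k))].
Qed.

(** Orthonormality of the [phi k]: averaging over [X i] removes the cross terms of the squared
    linear form. *)
Lemma ex_sqr_lin (Z : nat -> Omega -> R) U i : (i < n)%N ->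
  (forall k, obmeas X n i (Z k)) -> obmeas X n i U ->
  E (fun om => (\sum_(0 <= k < N) phi k (X i om) * Z k om) ^+ 2 * U om) =
  E (fun om => (\sum_(0 <= k < N) Z k om ^+ 2) * U om).
Proof.
move=> ltin oZ oU.
have bZ k := obmeas_bmeas XI (oZ k); have bU := obmeas_bmeas XI oU.
have bpp k l : bmeas (fun x => phi k x * phi l x).
  by apply: bmeasM; exact: bmeas_phi.
have oZZ k l : obmeas X n i (fun om => Z k om * Z l om * U om).
  by apply: bmeasM => //; exact: bmeasM (oZ k) (oZ l).
have bt k l : bmeas (fun om => phi k (X i om) * phi l (X i om) * (Z k om * Z l om * U om)).
  by apply: bmeasM; [exact: (bmeas_compX XI i (bpp k l))|exact: (obmeas_bmeas XI)].
transitivity (\sum_(0 <= k < N) \sum_(0 <= l < N)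
    E (fun om => phi k (X i om) * phi l (X i om) * (Z k om * Z l om * U om))).
  under [RHS]eq_bigr => k _ do rewrite -ex_sum//.
  rewrite -ex_sum => [|k _]; last by apply: bmeas_sum => l.
  apply: ex_ext => om; rewrite expr2 big_distrlr big_distrl/=.
  apply: eq_bigr => k _; rewrite big_distrl/=; apply: eq_bigr => l _; ring.
under [RHS]ex_ext => om do rewrite big_distrl/=.
rewrite [RHS]ex_sum => [|k _]; last by bm.
apply: eq_big_nat => k /andP[_ kN].
under eq_bigr => l _ do rewrite (ex_mul XI ltin (bpp k l) (oZZ k l)) phi_orth.
rewrite (bigD1_seq k)//= ?iota_uniq ?mem_index_iota//.
rewrite eqxx mul1r big1 ?addr0 => [|l lk]; last by rewrite eq_sym (negbTE lk) mul0r.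
by apply: ex_ext => om; ring.
Qed.

Lemma ex_Tsum_sqr s k : uniq s -> {in s, forall j, (j < n)%N} ->
  E (fun om => Tsum s k om ^+ 2) = (size s)%:R.
Proof.
elim: s => [_ _|i s IH /= /andP[is_ us] sn].
  by under ex_ext => om do rewrite /Tsum big_nil expr0n/=; rewrite ex_cst.
have ltin : (i < n)%N by apply: sn; rewrite inE eqxx.
have sn' : {in s, forall j, (j < n)%N} by move=> j js; apply: sn; rewrite inE js orbT.
have oT := obmeas_Tsum k sn' is_; have bT := bmeas_Tsum s k; have bp := bmeas_phiX k i.
transitivity (E (fun om => phi k (X i om) * phi k (X i om))
   + 2 * E (fun om => phi k (X i om) * Tsum s k om) + E (fun om => Tsum s k om ^+ 2)).
  rewrite -exZ; last by bm.
  rewrite -exD; [|by bm|by bm].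
  rewrite -exD; [|by bm|by bm].
  by apply: ex_ext => om; rewrite /Tsum big_cons; ring.
rewrite IH// (ex_phiX_mul k ltin oT) mulr0 addr0.
have bpp : bmeas (fun x => phi k x * phi k x).
  by apply: bmeasM; exact: bmeas_phi.
have := ex_mul XI ltin bpp (bmeas_cst 1); rewrite ex_cst phi_orth eqxx mulr1.
under ex_ext => om do rewrite mulr1.
by move=> ->; rewrite -addn1 natrD addrC.
Qed.

Lemma ex_Qsum s : uniq s -> {in s, forall j, (j < n)%N} ->
  E (Qsum s) = (size s)%:R * vsum.
Proof.
move=> us sn; have bT k := bmeas_Tsum s k.
rewrite /Qsum ex_sum => [|k _]; last by bm.
rewrite /vsum big_distrr/=; apply: eq_bigr => k _.
under ex_ext => om do rewrite exprMn.
by rewrite exZ ?ex_Tsum_sqr//; [rewrite mulrC|bm].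
Qed.

Lemma ex_Ysum_sqr i s : (i < n)%N -> uniq s -> {in s, forall j, (j < n)%N} ->
  i \notin s -> E (fun om => Ysum i s om ^+ 2) = (size s)%:R * vsum.
Proof.
move=> ltin us sn is_; rewrite -ex_Qsum//.
under ex_ext => om do rewrite -[_ ^+ 2]mulr1.
rewrite (ex_sqr_lin ltin (fun k => obmeas_wTsum k sn is_) (bmeas_cst 1)).
by apply: ex_ext => om; rewrite mulr1.
Qed.

Let sum_wphi_ge0 x : 0 <= \sum_(0 <= k < N) (w k * phi k x) ^+ 2.
Proof. by apply: sumr_ge0 => k _; exact: sqr_ge0. Qed.

(** The left side is the second moment of [H (x, X_j)] for fixed [x]. *)
Let sum_wphi_le x : \sum_(0 <= k < N) (w k * phi k x) ^+ 2 <= M ^+ 2 * vsum.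
Proof.
rewrite /vsum mulr_sumr; apply: ler_sum => k _.
rewrite exprMn mulrC ler_wpM2r ?sqr_ge0//.
by rewrite -[leLHS]real_normK ?num_real// lerXn2r ?nnegrE.
Qed.

(** A martingale-like induction: a new index [i] adds [2 B + u (X i)] to the centred sum [A], with
    [B] linear in the [phi k (X i)] and [u (X i)] the diagonal part minus [vsum]. Both are
    orthogonal to [A], so the variance grows by at most [8 E B^2 + 2 E u^2]. *)
Lemma var_Qsum s : uniq s -> {in s, forall j, (j < n)%N} ->
  E (fun om => (Qsum s om - (size s)%:R * vsum) ^+ 2) <=
  (size s)%:R * (8 * (size s)%:R * vsum + 2 * M ^+ 4 * vsum ^+ 2).
Proof.
elim: s => [_ _|i s IH /= /andP[is_ us] sn].
  rewrite [leRHS]mul0r ex_eq0// => om; rewrite mul0r subr0 /Qsum big1 ?expr0n// => k _.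
  by rewrite /Tsum big_nil mulr0 expr0n.
have ltin : (i < n)%N by apply: sn; rewrite inE eqxx.
have sn' : {in s, forall j, (j < n)%N} by move=> j js; apply: sn; rewrite inE js orbT.
set m : R := (size s)%:R; rewrite -/m in IH.
have m0 : 0 <= m by rewrite ler0n.
have v0 := vsum_ge0.
pose Z k om := w k * (w k * Tsum s k om).
have oZ k : obmeas X n i (Z k).
  by apply: bmeasM; [exact: bmeas_cst|exact: obmeas_wTsum].
pose B om := \sum_(0 <= k < N) phi k (X i om) * Z k om.
pose A om := Qsum s om - m * vsum.
pose u x := \sum_(0 <= k < N) (w k * phi k x) ^+ 2 - vsum.
have bu : bmeas u.
  apply: bmeasB; last exact: bmeas_cst.
  by apply: bmeas_sum => k; apply: bmeasX; apply: bmeasM; [exact: bmeas_cst|exact: bmeas_phi].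
have bC := bmeas_compX XI i bu.
have oA : obmeas X n i A.
  by apply: bmeasB; [exact: obmeas_Qsum|exact: bmeas_cst].
have bA := obmeas_bmeas XI oA.
have bZ k := obmeas_bmeas XI (oZ k).
have bB : bmeas B.
  by apply: bmeas_sum => k; apply: bmeasM => //; exact: bmeas_phiX.
have EQ om : Qsum (i :: s) om - (size s).+1%:R * vsum = A om + 2 * B om + u (X i om).
  rewrite -addn1 natrD -/m /A /u /B /Qsum mulr_sumr mulrDl mul1r.
  have -> : \sum_(0 <= k < N) (w k * Tsum (i :: s) k om) ^+ 2 =
    \sum_(0 <= k < N) (w k * Tsum s k om) ^+ 2
    + \sum_(0 <= k < N) 2 * (phi k (X i om) * Z k om)
    + \sum_(0 <= k < N) (w k * phi k (X i om)) ^+ 2.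
    rewrite -!big_split/=; apply: eq_bigr => k _.
    by rewrite /Tsum big_cons /Z /Tsum; ring.
  ring.
have EB2 : E (fun om => B om ^+ 2) <= m * vsum.
  rewrite -ex_Qsum//; under ex_ext => om do rewrite -[_ ^+ 2]mulr1.
  rewrite (ex_sqr_lin ltin oZ (bmeas_cst 1)).
  apply: ex_le => [| |om]; [by bm|exact: bmeas_Qsum|].
  rewrite mulr1; apply: ler_sum => k _.
  by rewrite /Z exprMn ler_piMl ?sqr_ge0// expr_le1.
have EAB : E (fun om => B om * A om) = 0 by exact: ex_lin.
have EAC : E (fun om => u (X i om) * A om) = 0.
  rewrite (ex_mul XI ltin bu oA).
  suff -> : E A = 0 by rewrite mulr0.
  rewrite /A exB; [|exact: bmeas_Qsum|exact: bmeas_cst].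
  by rewrite ex_cst ex_Qsum// subrr.
have C2 om : u (X i om) ^+ 2 <= M ^+ 4 * vsum ^+ 2.
  rewrite (exprM M 2 2) -exprMn -[leLHS]real_normK ?num_real//.
  have vM : vsum <= M ^+ 2 * vsum by rewrite ler_peMl// expr_ge1.
  rewrite lerXn2r ?nnegrE ?normr_ge0 ?mulr_ge0 ?sqr_ge0// ler_norml /u.
  have := sum_wphi_ge0 (X i om); have := sum_wphi_le (X i om).
  by move=> h1 h2; apply/andP; split; lra.
have -> : E (fun om => (Qsum (i :: s) om - (size s).+1%:R * vsum) ^+ 2) =
  E (fun om => (A om + 2 * B om + u (X i om)) ^+ 2).
  by apply: ex_ext => om; rewrite EQ.
apply: (@le_trans _ _ (E (fun om => A om ^+ 2 + (4 * (B om * A om)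
   + 2 * (u (X i om) * A om)) + (8 * B om ^+ 2 + 2 * (M ^+ 4 * vsum ^+ 2))))).
  apply: ex_le => [| |om]; [by bm|by bm|].
  rewrite -subr_ge0.
  (* This is the exact difference of the two sides, from [(2 B + u)^2 = 8 B^2 + 2 u^2 - (2 B -
     u)^2]. *)
  apply: (@le_trans _ _ ((2 * B om - u (X i om)) ^+ 2 + 2 * (M ^+ 4 * vsum ^+ 2 - u (X i om) ^+ 2))).
    by rewrite addr_ge0 ?sqr_ge0// mulr_ge0// subr_ge0.
  by rewrite le_eqVlt; apply/orP; left; apply/eqP; ring.
rewrite exD; [|by bm|by bm].
rewrite exD; [|by bm|by bm].
rewrite exD; [|by bm|by bm].
rewrite exD; [|by bm|by bm].
rewrite !exZ; [|by bm..].
rewrite EAB EAC ex_cst -[(size s).+1%:R]natr1 -/m.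
have := IH us sn'; rewrite -/A.
have c0 : 0 <= M ^+ 4 * vsum ^+ 2 by rewrite mulr_ge0 ?exprn_ge0.
by have := mulr_ge0 m0 v0; nra.
Qed.

(** Here [X i] counts among the other observations and the new [X j] is averaged out: with
    [h = H (X_i, X_j)], the term [h Y^3] has mean zero, [h^2 Y^2] gives the part in [vsum^2], and
    [h^4] is at most the squared supremum of [h] times [h^2], which gives the part in [Lsum^2]. *)
Lemma ex_Ysum_pow4 i s : (i < n)%N -> uniq s -> {in s, forall j, (j < n)%N} ->
  i \notin s -> E (fun om => Ysum i s om ^+ 4) <=
  (size s)%:R * (8 * M ^+ 2 * vsum ^+ 2 * (size s)%:R + 3 * M ^+ 6 * Lsum ^+ 2 * vsum).
Proof.
move=> ltin; elim: s => [_ _ _|j s IH /= /andP[js us] sn].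
  rewrite [leRHS]mul0r ex_eq0// => om; rewrite /Ysum big1 ?expr0n// => k _.
  by rewrite /Tsum big_nil !mulr0.
rewrite inE negb_or => /andP[ij is_].
have ltjn : (j < n)%N by apply: sn; rewrite inE eqxx.
have sn' : {in s, forall j, (j < n)%N} by move=> k ks; apply: sn; rewrite inE ks orbT.
set m : R := (size s)%:R; rewrite -/m in IH.
have m0 : 0 <= m by rewrite ler0n.
have v0 := vsum_ge0; have l0 := Lsum_ge0.
pose Z k om := w k * phi k (X i om).
have oZ k : obmeas X n j (Z k).
  by apply: bmeasM; [exact: bmeas_cst|exact: obmeas_phiX].
have bZ k := obmeas_bmeas XI (oZ k).
pose h om := \sum_(0 <= k < N) phi k (X j om) * Z k om.
have oY : obmeas X n j (Ysum i s) by exact: obmeas_Ysum.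
have bY := obmeas_bmeas XI oY.
have bh : bmeas h.
  by apply: bmeas_sum => k; apply: bmeasM => //; exact: bmeas_phiX.
have EY om : Ysum i (j :: s) om = Ysum i s om + h om.
  rewrite /Ysum /h -big_split/=; apply: eq_bigr => k _.
  by rewrite /Tsum big_cons /Z; ring.
have EhY3 : E (fun om => h om * Ysum i s om ^+ 3) = 0.
  by apply: ex_lin => //; exact: bmeasX oY.
have EhY2 : E (fun om => h om ^+ 2 * Ysum i s om ^+ 2) <= M ^+ 2 * vsum * (m * vsum).
  rewrite (ex_sqr_lin ltjn oZ (bmeasX 2 oY)) -(ex_Ysum_sqr ltin us sn' is_) -exZ; last by bm.
  apply: ex_le => [| |om]; [by bm|by bm|].
  by rewrite ler_wpM2r ?sqr_ge0//; exact: sum_wphi_le.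
have Eh2 : E (fun om => h om ^+ 2) <= M ^+ 2 * vsum.
  under ex_ext => om do rewrite -[_ ^+ 2]mulr1.
  rewrite (ex_sqr_lin ltjn oZ (bmeas_cst 1)) -[leRHS](ex_cst P).
  apply: ex_le => [| |om]; [by bm|by bm|].
  by rewrite mulr1; exact: sum_wphi_le.
have hL om : `|h om| <= M ^+ 2 * Lsum.
  rewrite /h (le_trans (ler_norm_sum _ _ _))// /Lsum mulr_sumr.
  apply: ler_sum => k _; rewrite /Z !normrM (ger0_norm (w0 k)) mulrCA [leRHS]mulrC.
  by rewrite ler_wpM2l// ler_pM.
have Eh4 : E (fun om => h om ^+ 4) <= (M ^+ 2 * Lsum) ^+ 2 * (M ^+ 2 * vsum).
  apply: (@le_trans _ _ ((M ^+ 2 * Lsum) ^+ 2 * E (fun om => h om ^+ 2))); last first.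
    by rewrite ler_wpM2l// sqr_ge0.
  rewrite -exZ; last by bm.
  apply: ex_le => [| |om]; [by bm|by bm|].
  rewrite (exprD (h om) 2 2) ler_wpM2r ?sqr_ge0//.
  by rewrite -[leLHS]real_normK ?num_real// lerXn2r ?nnegrE// mulr_ge0 ?sqr_ge0.
have -> : E (fun om => Ysum i (j :: s) om ^+ 4) = E (fun om => (Ysum i s om + h om) ^+ 4).
  by apply: ex_ext => om; rewrite EY.
apply: (@le_trans _ _ (E (fun om => Ysum i s om ^+ 4 + (4 * (h om * Ysum i s om ^+ 3))
   + (8 * (h om ^+ 2 * Ysum i s om ^+ 2) + 3 * h om ^+ 4)))).
  apply: ex_le => [| |om]; [by bm|by bm|].
  rewrite -subr_ge0.
  (* This square absorbs the odd term [4 Y h^3] of the expansion, turning [6 h^2 Y^2 + h^4] into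
     [8 h^2 Y^2 + 3 h^4]. *)
  have : 0 <= 2 * (h om * (Ysum i s om - h om)) ^+ 2 by rewrite mulr_ge0// sqr_ge0.
  by move=> /le_trans; apply; rewrite le_eqVlt; apply/orP; left; apply/eqP; ring.
rewrite exD; [|by bm|by bm].
rewrite exD; [|by bm|by bm].
rewrite exD; [|by bm|by bm].
rewrite !exZ; [|by bm..].
rewrite EhY3 -[(size s).+1%:R]natr1 -/m.
have := IH us sn' is_.
have e4 : (M ^+ 2 * Lsum) ^+ 2 * (M ^+ 2 * vsum) = M ^+ 6 * Lsum ^+ 2 * vsum by ring.
rewrite e4 in Eh4.
have c0 : 0 <= M ^+ 6 * Lsum ^+ 2 * vsum by rewrite !mulr_ge0 ?exprn_ge0.
have e2 : M ^+ 2 * vsum * (m * vsum) = M ^+ 2 * vsum ^+ 2 * m by ring.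
rewrite e2 in EhY2.
have d0 : 0 <= M ^+ 2 * vsum ^+ 2 by rewrite mulr_ge0 ?exprn_ge0.
have := mulr_ge0 d0 m0.
set c := M ^+ 6 * _ * _ in c0 Eh4 *; set dd := M ^+ 2 * _ in d0 EhY2 *.
have -> : 8 * M ^+ 2 * vsum ^+ 2 * m = 8 * (dd * m) by rewrite /dd; ring.
have -> : 3 * M ^+ 6 * Lsum ^+ 2 * vsum = 3 * c by rewrite /c; ring.
have -> : 8 * M ^+ 2 * vsum ^+ 2 * (m + 1) = 8 * (dd * m) + 8 * dd by rewrite /dd; ring.
by move=> dm0; nra.
Qed.

(* The sum of [H (X_i, X_j)] over the ordered pairs [i <> j] of [s]. *)
Definition Usum (s : seq nat) om :=
  \sum_(0 <= k < N) w k * (Tsum s k om ^+ 2 - \sum_(j <- s) phi k (X j om) ^+ 2).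

Lemma Tsum_rem i s k om : i \in s ->
  Tsum s k om = phi k (X i om) + Tsum (rem i s) k om.
Proof. by move=> is_; rewrite /Tsum (big_rem i is_). Qed.

Lemma Usum_rem i s om : i \in s ->
  Usum s om = Usum (rem i s) om + 2 * Ysum i (rem i s) om.
Proof.
move=> is_; rewrite /Usum /Ysum mulr_sumr -big_split/=; apply: eq_bigr => k _.
by rewrite (Tsum_rem _ _ is_) (big_rem i is_)/=; ring.
Qed.

Lemma Usum_Ysum s om : Usum s om = \sum_(i <- s) Ysum i (rem i s) om.
Proof.
have -> : \sum_(i <- s) Ysum i (rem i s) om = \sum_(i <- s) \sum_(0 <= k < N)
   phi k (X i om) * (w k * (Tsum s k om - phi k (X i om))).
  rewrite big_seq [RHS]big_seq; apply: eq_bigr => i is_; apply: eq_bigr => k _.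
  by rewrite (Tsum_rem _ _ is_); ring.
rewrite exchange_big/=; apply: eq_bigr => k _.
have -> : \sum_(i <- s) phi k (X i om) * (w k * (Tsum s k om - phi k (X i om)))
  = \sum_(i <- s) (w k * Tsum s k om) * phi k (X i om)
   - \sum_(i <- s) w k * phi k (X i om) ^+ 2.
  by rewrite -sumrB; apply: eq_bigr => i _; ring.
by rewrite -!mulr_sumr -/(Tsum s k om); ring.
Qed.

Lemma bmeas_Usum s : bmeas (Usum s).
Proof.
apply: bmeas_sum => k; apply: bmeasM; first exact: bmeas_cst.
apply: bmeasB; first by apply: bmeasX; exact: bmeas_Tsum.
by apply: bmeas_sum => j; apply: bmeasX; exact: bmeas_phiX.
Qed.

Lemma obmeas_Usum i s : {in s, forall j, (j < n)%N} -> i \notin s ->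
  obmeas X n i (Usum s).
Proof.
move=> sn is_; apply: bmeas_sum => k; apply: bmeasM; first exact: bmeas_cst.
apply: bmeasB; first by apply: bmeasX; exact: obmeas_Tsum.
apply: bmeas_sum_seq => j js; apply: bmeasX.
apply: obmeas_phiX => //; first exact: sn.
by apply: contraNneq is_ => <-.
Qed.

Let I := iota 0 n.
Let uI : uniq I. Proof. exact: iota_uniq. Qed.
Let ltI i : i \in I -> (i < n)%N. Proof. by rewrite mem_iota. Qed.
Let r i := rem i I.
Let ur i : uniq (r i). Proof. exact: rem_uniq. Qed.
Let lt_r i : {in r i, forall j, (j < n)%N}.
Proof. by move=> j /mem_rem /ltI. Qed.
Let ir i : i \notin r i. Proof. by rewrite mem_rem_uniqF. Qed.
Let sr i : i \in I -> size (r i) = n.-1.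
Proof. by move=> iI; rewrite size_rem// size_iota. Qed.

Local Notation m := (n.-1%:R : R).

(** * Stein bound for the truncated statistic *)

Section test_function.
Variables (f f' : R -> R) (K c : R).
Hypothesis mf : measurable_fun setT f.
Hypothesis mf' : measurable_fun setT f'.
Hypothesis fK : forall x, `|f x| <= K.
Hypothesis f'K : forall x, `|f' x| <= K.
Hypothesis f_taylor : forall x y, `|f y - f x - (y - x) * f' x| <= K * (y - x) ^+ 2.
Hypothesis f'_lip : forall x y, `|f' y - f' x| <= K * `|y - x|.
Hypothesis c0 : 0 <= c.

Let W om := c * Usum I om.

Lemma bmeas_W : bmeas (fun om => c * Usum I om).
Proof. by apply: bmeasM; [exact: bmeas_cst|exact: bmeas_Usum]. Qed.

(** With [W = Wi + 2 c Y] and [Wi] free of [X i], the main terms are [E (Y f(Wi)) = 0] and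
    [E (Y^2 f'(Wi)) = E (Q f'(Wi))]. *)
Lemma stein_term i : (i < n)%N ->
  `|c * E (fun om => Ysum i (r i) om * f (W om))
    - 2 * c ^+ 2 * (m * vsum) * E (fun om => f' (W om))| <=
  K * (4 * E (fun om => `|c * Ysum i (r i) om| ^+ 3)
    + 2 * c ^+ 2 * E (fun om => `|Qsum (r i) om - m * vsum|)
    + 4 * (c ^+ 2 * (m * vsum)) * E (fun om => `|c * Ysum i (r i) om|)).
Proof.
move=> ltin; have iI : i \in I by rewrite mem_iota.
have v0 := vsum_ge0.
pose Y := Ysum i (r i); pose Q := Qsum (r i).
pose Wi om := c * Usum (r i) om.
have WE om : W om = Wi om + 2 * c * Y om.
  by rewrite /W (Usum_rem _ iI) /Wi /Y /r; ring.
have bY : bmeas Y by exact: bmeas_Ysum.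
have bQ : bmeas Q by exact: bmeas_Qsum.
have oWi : obmeas X n i Wi.
  by apply: bmeasM; [exact: bmeas_cst|exact: obmeas_Usum].
have bWi := obmeas_bmeas XI oWi.
have bW := bmeas_W; rewrite -/W in bW.
have ofW : obmeas X n i (fun om => f (Wi om)) := bmeas_comp mf fK (proj1 oWi).
have of'W : obmeas X n i (fun om => f' (Wi om)) := bmeas_comp mf' f'K (proj1 oWi).
have bfWi := obmeas_bmeas XI ofW; have bf'Wi := obmeas_bmeas XI of'W.
have bfW : bmeas (fun om => f (W om)) := bmeas_comp mf fK (proj1 bW).
have bf'W : bmeas (fun om => f' (W om)) := bmeas_comp mf' f'K (proj1 bW).
have oZ k := obmeas_wTsum k (@lt_r i) (ir i).
have Ef : E (fun om => Y om * f (Wi om)) = 0.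
  exact: (ex_lin ltin oZ ofW).
have Ef' : E (fun om => Y om ^+ 2 * f' (Wi om)) = E (fun om => Q om * f' (Wi om)).
  exact: (ex_sqr_lin ltin oZ of'W).
(* The three errors: the Taylor remainder, the fluctuation of the conditional variance [Q] around
   its mean, and the replacement of [Wi] by [W] inside [f']. *)
pose e1 om := c * Y om * (f (W om) - f (Wi om) - (W om - Wi om) * f' (Wi om)).
pose e2 om := 2 * c ^+ 2 * ((Q om - m * vsum) * f' (Wi om)).
pose e3 om := 2 * c ^+ 2 * (m * vsum) * (f' (Wi om) - f' (W om)).
have -> : c * E (fun om => Y om * f (W om))
    - 2 * c ^+ 2 * (m * vsum) * E (fun om => f' (W om)) =
    E (fun om => e1 om + e2 om + e3 om).
  transitivity (E (fun om => e1 om + e2 om + e3 om)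
    + (c * E (fun om => Y om * f (Wi om)) + 2 * c ^+ 2 *
     (E (fun om => Y om ^+ 2 * f' (Wi om)) - E (fun om => Q om * f' (Wi om))))).
    rewrite -exB; [|by bm|by bm].
    rewrite -!exZ; [|by bm..].
    rewrite -exB; [|by bm|by bm].
    rewrite -exD; [|by bm|by bm].
    rewrite -exD; [|by rewrite /e1 /e2 /e3; bm|by bm].
    apply: ex_ext => om; rewrite /e1 /e2 /e3.
    have -> : W om - Wi om = 2 * c * Y om by rewrite WE; ring.
    by ring.
  by rewrite Ef Ef' subrr !mulr0 !addr0.
rewrite -!exZ; [|by bm..].
rewrite -!exD; [|by bm..].
rewrite -exZ; last by bm.
apply: ex_norm_le; [by rewrite /e1 /e2 /e3; bm|by bm|move=> om].
rewrite (le_trans (ler_normD _ _))// mulrDr lerD//.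
  rewrite (le_trans (ler_normD _ _))// mulrDr lerD//.
    rewrite /e1 normrM.
    have dW : W om - Wi om = 2 * (c * Y om) by rewrite WE; ring.
    have := f_taylor (Wi om) (W om); rewrite {2}dW.
    move/(ler_wpM2l (normr_ge0 (c * Y om)))/le_trans; apply.
    rewrite exprMn -[(c * Y om) ^+ 2]real_normK ?num_real//.
    by rewrite le_eqVlt; apply/orP; left; apply/eqP; ring.
  have h0 : 0 <= 2 * c ^+ 2 by rewrite mulr_ge0 ?exprn_ge0.
  rewrite /e2 normrM (ger0_norm h0) normrM
    [leRHS](_ : _ = 2 * c ^+ 2 * (`|Q om - m * vsum| * K)); last by ring.
  by rewrite ler_wpM2l// ler_wpM2l.
have g0 : 0 <= 2 * c ^+ 2 * (m * vsum) by rewrite !mulr_ge0// ?ler0n// exprn_ge0.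
rewrite /e3 normrM (ger0_norm g0).
have := f'_lip (W om) (Wi om).
have -> : Wi om - W om = - (2 * (c * Y om)) by rewrite WE; ring.
rewrite normrN normrM (ger0_norm (_ : 0 <= 2)) ?ler0n//.
move/(ler_wpM2l g0)/le_trans; apply.
by rewrite le_eqVlt; apply/orP; left; apply/eqP; ring.
Qed.

(** The term in [vsum^-1] stems from the variance of [Qsum], the last one from the fourth moments of
    the [Ysum]; [1/n] occurs in every estimate, and also as the price of [n - 1] in place of [n]. *)
Definition stein_rate : R := n%:R^-1 + vsum^-1 + Lsum ^+ 2 / (n%:R ^+ 2 * vsum).

Hypothesis n0 : (0 < n)%N.
Hypothesis cv : c ^+ 2 * (n%:R ^+ 2 * vsum) = 1.

Let q : R := n%:R.
Let q0 : 0 < q. Proof. by rewrite ltr0n. Qed.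
Let m0 : 0 <= m. Proof. by rewrite ler0n. Qed.
Let mE : m = q - 1. Proof. by rewrite /q -[in RHS](prednK n0) -natr1 addrK. Qed.
Let mq : m <= q. Proof. by rewrite mE lerBlDr lerDl. Qed.
Let v0 : 0 < vsum.
Proof.
rewrite lt_neqAle vsum_ge0 andbT; apply: contraPneq cv => <-.
by rewrite !mulr0 => /eqP; rewrite eq_sym oner_eq0.
Qed.
Let K0 : 0 <= K. Proof. exact: le_trans (normr_ge0 _) (fK 0). Qed.
Let gE : c ^+ 2 = (q ^+ 2 * vsum)^-1.
Proof.
have qv : q ^+ 2 * vsum != 0 by rewrite gt_eqF// mulr_gt0// exprn_gt0.
by apply: (mulIf qv); rewrite cv mulVf.
Qed.

(** The second moments of the [n] variables [c Y_i] add up to [(n - 1) / n]. *)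
Lemma cmv_le : q * (c ^+ 2 * (m * vsum)) <= 1.
Proof.
rewrite gE.
have -> : q * ((q ^+ 2 * vsum)^-1 * (m * vsum)) = m / q.
  by field; rewrite !gt_eqF.
by rewrite ler_pdivrMr// mul1r.
Qed.

Lemma ex_cYsum_sqr i : (i < n)%N ->
  E (fun om => (c * Ysum i (r i) om) ^+ 2) = c ^+ 2 * (m * vsum).
Proof.
move=> ltin; have iI : i \in I by rewrite mem_iota.
have bY := bmeas_Ysum i (r i).
under ex_ext => om do rewrite exprMn.
rewrite exZ; last by bm.
by rewrite (ex_Ysum_sqr ltin (ur i) (@lt_r i) (ir i)) sr.
Qed.

(** In this and the next two estimates the factor [q] anticipates the sum over the [n] indices, for
    all of which the bound is the same. *)
Lemma ex_cYsum3 i a : (i < n)%N -> 0 < a ->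
  q * E (fun om => `|c * Ysum i (r i) om| ^+ 3) <=
  a + (8 * M ^+ 2 / q + 3 * M ^+ 6 * (Lsum ^+ 2 / (q ^+ 2 * vsum))) / a.
Proof.
move=> ltin a0; have iI : i \in I by rewrite mem_iota.
have bY := bmeas_Ysum i (r i).
have bcY : bmeas (fun om => c * Ysum i (r i) om) by bm.
have := ex_norm3_amgm P a0 bcY; rewrite ex_cYsum_sqr//.
move/(ler_wpM2l (ltW q0))/le_trans; apply.
rewrite mulrDr lerD//.
  by rewrite mulrCA ler_piMr ?cmv_le// ltW.
rewrite (mulrA q) ler_wpM2r ?invr_ge0 ?(ltW a0)//.
under ex_ext => om do rewrite exprMn.
rewrite exZ; last by bm.
have := ex_Ysum_pow4 ltin (ur i) (@lt_r i) (ir i).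
rewrite sr// => h.
have c4 : 0 <= q * c ^+ 4 by rewrite mulr_ge0 ?exprn_ge0// ltW.
rewrite (mulrA q) (le_trans (ler_wpM2l c4 h))//.
have d0 : 0 <= 8 * M ^+ 2 * vsum ^+ 2.
  by rewrite !mulr_ge0 ?exprn_ge0 ?(ltW v0).
have e0 : 0 <= 3 * M ^+ 6 * Lsum ^+ 2 * vsum.
  by rewrite !mulr_ge0 ?exprn_ge0 ?(ltW v0) ?Lsum_ge0.
apply: (@le_trans _ _ (q * c ^+ 4 * (q * (8 * M ^+ 2 * vsum ^+ 2 * q
    + 3 * M ^+ 6 * Lsum ^+ 2 * vsum)))).
  rewrite ler_wpM2l// ler_pM//; last by rewrite lerD2r ler_wpM2l.
  by rewrite addr_ge0// mulr_ge0.
rewrite (exprM c 2 2) gE le_eqVlt; apply/orP; left; apply/eqP.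
by field; rewrite !gt_eqF.
Qed.

Lemma ex_Qsum_dev i a : (i < n)%N -> 0 < a ->
  q * (c ^+ 2 * E (fun om => `|Qsum (r i) om - m * vsum|)) <=
  a + (8 / vsum + 2 * M ^+ 4 / q) / a.
Proof.
move=> ltin a0; have iI : i \in I by rewrite mem_iota.
have bQ := bmeas_Qsum (r i).
have g0 : 0 <= q * c ^+ 2 by rewrite mulr_ge0 ?exprn_ge0// ltW.
have bZ : bmeas (fun om => q * c ^+ 2 * (Qsum (r i) om - m * vsum)) by bm.
have := ex_norm_amgm P a0 bZ.
under ex_ext => om do rewrite normrM (ger0_norm g0).
rewrite exZ; last by bm.
rewrite (mulrA q) => /le_trans; apply; rewrite lerD2l ler_wpM2r ?invr_ge0 ?(ltW a0)//.
under ex_ext => om do rewrite exprMn.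
rewrite exZ; last by bm.
have := var_Qsum (ur i) (@lt_r i).
rewrite sr// => h.
have g2 : 0 <= (q * c ^+ 2) ^+ 2 by exact: sqr_ge0.
rewrite (le_trans (ler_wpM2l g2 h))//.
have M40 : 0 <= 2 * M ^+ 4 * vsum ^+ 2.
  by rewrite !mulr_ge0 ?exprn_ge0 ?(ltW v0).
apply: (@le_trans _ _ ((q * c ^+ 2) ^+ 2 * (q * (8 * q * vsum + 2 * M ^+ 4 * vsum ^+ 2)))).
  rewrite ler_wpM2l// ler_pM//.
    by rewrite addr_ge0// !mulr_ge0// ltW.
  by rewrite lerD2r ler_wpM2r ?(ltW v0)// ler_wpM2l.
rewrite gE le_eqVlt; apply/orP; left; apply/eqP.
by field; rewrite !gt_eqF.
Qed.

Lemma ex_cYsum1 i a : (i < n)%N -> 0 < a ->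
  q * (c ^+ 2 * (m * vsum) * E (fun om => `|c * Ysum i (r i) om|)) <= a + q^-1 / a.
Proof.
move=> ltin a0.
have bY := bmeas_Ysum i (r i).
have bcY : bmeas (fun om => c * Ysum i (r i) om) by bm.
apply: (@le_trans _ _ (E (fun om => `|c * Ysum i (r i) om|))).
  by rewrite (mulrA q) ler_piMl ?cmv_le//; apply: ex_ge0.
apply: le_trans (ex_norm_amgm P a0 bcY) _; rewrite lerD2l ex_cYsum_sqr//.
rewrite ler_wpM2r ?invr_ge0 ?(ltW a0)//.
by rewrite -[leRHS]mul1r ler_pdivlMr// mulrC cmv_le.
Qed.

Lemma stein_bound a : 0 < a <= 1 ->
  `|E (fun om => W om * f (W om)) - 2 * E (fun om => f' (W om))| <=
  K * (10 * a + 42 * M ^+ 6 * stein_rate / a).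
Proof.
move=> /andP[a0 a1].
have bW := bmeas_W; rewrite -/W in bW.
have bfW : bmeas (fun om => f (W om)) := bmeas_comp mf fK (proj1 bW).
have bf'W : bmeas (fun om => f' (W om)) := bmeas_comp mf' f'K (proj1 bW).
have bY i : bmeas (Ysum i (r i)) by exact: bmeas_Ysum.
have EW : E (fun om => W om * f (W om)) =
    \sum_(i <- I) c * E (fun om => Ysum i (r i) om * f (W om)).
  transitivity (E (fun om => \sum_(i <- I) c * (Ysum i (r i) om * f (W om)))).
    apply: ex_ext => om; rewrite {1}/W Usum_Ysum mulr_sumr mulr_suml.
    by apply: eq_bigr => i _; rewrite mulrA.
  rewrite ex_sum => [|i _]; last by bm.
  by apply: eq_bigr => i _; rewrite exZ//; bm.
have EF : `|E (fun om => f' (W om))| <= K.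
  rewrite -[leRHS](ex_cst P); apply: ex_norm_le => //; exact: bmeas_cst.
pose F := 2 * c ^+ 2 * (m * vsum) * E (fun om => f' (W om)).
pose S1 := 8 * M ^+ 2 / q + 3 * M ^+ 6 * (Lsum ^+ 2 / (q ^+ 2 * vsum)).
pose S2 := 8 / vsum + 2 * M ^+ 4 / q.
have h1 : `|E (fun om => W om * f (W om)) - q * F| <=
    K * (4 * (a + S1 / a) + 2 * (a + S2 / a) + 4 * (a + q^-1 / a)).
  have -> : q * F = \sum_(i <- I) F.
    by rewrite big_const_seq count_predT size_iota iter_addr_0 mulr_natl.
  rewrite EW -sumrB (le_trans (ler_norm_sum _ _ _))//.
  have -> : K * (4 * (a + S1 / a) + 2 * (a + S2 / a) + 4 * (a + q^-1 / a))
     = \sum_(i <- I) q^-1 * (K * (4 * (a + S1 / a) + 2 * (a + S2 / a) + 4 * (a + q^-1 / a))).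
    rewrite big_const_seq count_predT size_iota iter_addr_0 -[RHS]mulr_natl.
    by rewrite mulrA divff ?mul1r// gt_eqF.
  rewrite big_seq [leRHS]big_seq; apply: ler_sum => i iI; have ltin := ltI iI.
  apply: le_trans (stein_term ltin) _.
  rewrite (mulrCA q^-1) ler_wpM2l// -(ler_pM2l q0) (mulrA q q^-1) divff ?gt_eqF// mul1r.
  have := ex_cYsum3 ltin a0; have := ex_Qsum_dev ltin a0; have := ex_cYsum1 ltin a0.
  by rewrite -/S1 -/S2; lra.
(* The conditional variances add up to [2 (1 - 1/n)] rather than [2]; the gap costs [2 K / n]. *)
have qF : q * F = 2 * E (fun om => f' (W om)) - 2 / q * E (fun om => f' (W om)).
  by rewrite /F gE mE; field; rewrite !gt_eqF.
have q20 : 0 <= 2 / q by rewrite divr_ge0 ?(ltW q0).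
have h2 : `|E (fun om => W om * f (W om)) - 2 * E (fun om => f' (W om))| <=
   `|E (fun om => W om * f (W om)) - q * F| + 2 / q * K.
  have -> : E (fun om => W om * f (W om)) - 2 * E (fun om => f' (W om)) =
    E (fun om => W om * f (W om)) - q * F - 2 / q * E (fun om => f' (W om)).
    by rewrite qF; ring.
  rewrite (le_trans (ler_normB _ _))// lerD2l normrM (ger0_norm q20).
  by rewrite ler_wpM2l.
apply: le_trans h2 _; apply: le_trans (lerD h1 (lexx _)) _.
rewrite -[2 / q * K]mulrC -mulrDr ler_wpM2l//.
have M6 : 1 <= M ^+ 6 by rewrite exprn_ege1.
have M4 : M ^+ 4 <= M ^+ 6 by rewrite ler_weXn2l.
have M2 : M ^+ 2 <= M ^+ 6 by rewrite ler_weXn2l.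
have qi : 0 <= q^-1 by rewrite invr_ge0 (ltW q0).
have vi : 0 <= vsum^-1 by rewrite invr_ge0 (ltW v0).
have l0 : 0 <= Lsum ^+ 2 / (q ^+ 2 * vsum).
  by rewrite divr_ge0 ?sqr_ge0// mulr_ge0 ?sqr_ge0// (ltW v0).
(* The bound [a <= 1] lets [2 / q] join the terms divided by [a]. The constant 42 is the total
   coefficient [32 + 4 + 6] of [1/q] once [M^2], [M^4] and 1 are raised to [M^6]; the other two
   terms carry 16 and 12. *)
apply: (@le_trans _ _ (10 * a + (4 * S1 + 2 * S2 + 4 / q + 2 / q) / a)).
  have : 2 / q <= 2 / q / a by rewrite ler_peMr// invf_ge1.
  by lra.
rewrite lerD2l ler_wpM2r ?invr_ge0 ?(ltW a0)//.
rewrite /stein_rate /S1 /S2 -/q.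
have := ler_wpM2r qi M2; have := ler_wpM2r qi M4; have := ler_wpM2r qi M6.
have := ler_wpM2r vi M6; have := ler_wpM2r l0 M6.
move: (Lsum ^+ 2 / _) l0 => l l0; move: (vsum^-1) vi => y vi; move: (q^-1) qi => x qi.
by rewrite !mul1r; lra.
Qed.

(** The leave-one-out argument with [f] the identity is exact: [E (Y_i W) = 2 c E (Y_i^2)]. *)
Lemma ex_W2_le : E (fun om => W om ^+ 2) <= 2.
Proof.
have bW := bmeas_W; rewrite -/W in bW.
have bY i : bmeas (Ysum i (r i)) by exact: bmeas_Ysum.
have -> : E (fun om => W om ^+ 2) = \sum_(i <- I) c * E (fun om => Ysum i (r i) om * W om).
  transitivity (E (fun om => \sum_(i <- I) c * (Ysum i (r i) om * W om))).
    apply: ex_ext => om; rewrite expr2 {1}/W Usum_Ysum mulr_sumr mulr_suml.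
    by apply: eq_bigr => i _; rewrite mulrA.
  rewrite ex_sum => [|i _]; last by bm.
  by apply: eq_bigr => i _; rewrite exZ//; bm.
have -> : 2 = \sum_(i <- I) q^-1 * 2 :> R.
  rewrite big_const_seq count_predT size_iota iter_addr_0 -[RHS]mulr_natl.
  by rewrite mulrA divff ?mul1r// gt_eqF.
rewrite big_seq [leRHS]big_seq; apply: ler_sum => i iI; have ltin := ltI iI.
have oU : obmeas X n i (Usum (r i)) by exact: obmeas_Usum.
have bU := obmeas_bmeas XI oU.
have -> : E (fun om => Ysum i (r i) om * W om) =
   c * E (fun om => Ysum i (r i) om * Usum (r i) om) + 2 * c * E (fun om => Ysum i (r i) om ^+ 2).
  rewrite -!exZ; [|by bm..].
  rewrite -exD; [|by bm..].
  by apply: ex_ext => om; rewrite /W (Usum_rem _ iI) -/(r i); ring.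
rewrite (ex_lin ltin
  (fun k => obmeas_wTsum k (@lt_r i) (ir i)) oU).
rewrite (ex_Ysum_sqr ltin (ur i) (@lt_r i) (ir i)) sr//.
rewrite -(ler_pM2l q0) (mulrA q q^-1) divff ?gt_eqF// mul1r.
by have := cmv_le; lra.
Qed.

End test_function.

End moments.

(** * From limits inferior and superior to bounds for all indices *)

Section eventual_bounds.
Context {R : realType} (a : nat -> R).
Hypothesis a0 : forall k, 0 < a k.

Lemma finite_pos_lb n : exists2 c : R, 0 < c & forall k, (k < n)%N -> c <= a k.
Proof.
elim: n => [|n [c c0 cn]]; first by exists 1.
exists (Num.min c (a n)); first by rewrite lt_min c0 a0.
move=> k; rewrite ltnS leq_eqVlt => /predU1P[->|kn]; first by rewrite ge_min lexx orbT.
by rewrite ge_min cn.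
Qed.

Lemma finite_ub n : exists c : R, forall k, (k < n)%N -> a k <= c.
Proof.
elim: n => [|n [c cn]]; first by exists 1.
exists (Num.max c (a n)) => k.
rewrite ltnS leq_eqVlt => /predU1P[->|kn]; first by rewrite le_max lexx orbT.
by rewrite le_max cn.
Qed.

(** A positive limit inferior bounds a tail away from zero; the finitely many terms before it are
    positive. *)
Lemma limn_einf_gt0_lb : (0 < limn_einf (fun k => (a k)%:E))%E ->
  exists2 c : R, 0 < c & forall k, c <= a k.
Proof.
rewrite limn_einf_lim (cvg_lim _ (@cvg_einfs_sup _ _))// => /ereal_sup_gt[_ [n _ <-]] h.
have an k : (n <= k)%N -> (einfs (fun k => (a k)%:E) n <= (a k)%:E)%E.
  by move=> nk; apply: ereal_inf_lbound; exists k.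
have [c1 c10 h1] := finite_pos_lb n.
move: h an; rewrite /=; case: (einfs _ n) => [c| |] //.
- rewrite lte_fin => c0 an; exists (Num.min c c1); first by rewrite lt_min c0.
  move=> k; case: (leqP n k) => nk; last by rewrite ge_min h1// orbT.
  by rewrite ge_min; have := an _ nk; rewrite lee_fin => ->.
- by move=> _ /(_ n (leqnn n)); rewrite leye_eq.
Qed.

Lemma limn_esup_lty_ub : (limn_esup (fun k => (a k)%:E) < +oo)%E ->
  exists c : R, forall k, a k <= c.
Proof.
rewrite limn_esup_lim (cvg_lim _ (@cvg_esups_inf _ _))// => /ereal_inf_lt[_ [n _ <-]] h.
have an k : (n <= k)%N -> ((a k)%:E <= esups (fun k => (a k)%:E) n)%E.
  by move=> nk; apply: ereal_sup_ubound; exists k.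
have [c1 h1] := finite_ub n.
move: h an; rewrite /=; case: (esups _ n) => [c| |] //.
- move=> _ an; exists (Num.max c c1).
  move=> k; case: (leqP n k) => nk; last by rewrite le_max h1// orbT.
  by rewrite le_max; have := an _ nk; rewrite lee_fin => ->.
- by move=> _ /(_ n (leqnn n)); rewrite leeNy_eq.
Qed.

End eventual_bounds.

(** * Tails of power series *)

Section power_tail.
Context {R : realType}.

(** Integral comparison by exponentials: the ratio of [k^(-p)] to [(k+1)^(-p)] is
    [(1 - 1/(k+1))^(-p)], at least [exp (p/(k+1))], hence at least [1 + p/(k+1)]. *)
Lemma powR_telescope (p : R) (k : nat) : 0 < p -> (0 < k)%N ->
  p * k.+1%:R `^ (- (p + 1)) <= k%:R `^ (- p) - k.+1%:R `^ (- p).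
Proof.
move=> p0 k0; have k0' : (0 : R) < k%:R by rewrite ltr0n.
have K0 : (0 : R) < k.+1%:R by rewrite ltr0n.
set q := k.+1%:R `^ (- p).
have -> : k.+1%:R `^ (- (p + 1)) = q * k.+1%:R^-1.
  by rewrite opprD powRD ?(gt_eqF K0) ?implybT// powR_inv1 ?(ltW K0).
rewrite lerBrDr.
have -> : p * (q * k.+1%:R^-1) + q = q * (1 + p / k.+1%:R) by ring.
have lnk : ln (k%:R : R) <= ln (k.+1%:R : R) - k.+1%:R^-1.
  have h : ln (1 + - k.+1%:R^-1 : R) <= - k.+1%:R^-1.
    by apply: le_ln1Dx; rewrite ltrN2 invf_lt1// ltr1n ltnS.
  have <- : (k.+1%:R : R) * (1 + - k.+1%:R^-1) = k%:R.
    by rewrite mulrDr mulr1 mulrN divff ?gt_eqF// -natr1 addrK.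
  rewrite lnM ?posrE// ?lerD2l// subr_gt0 invf_lt1// ltr1n ltnS//.
rewrite [leRHS]/powR (gt_eqF k0').
apply: (@le_trans _ _ (expR (- p * ln k.+1%:R + p / k.+1%:R))).
  by rewrite expRD /q /powR gt_eqF// ler_wpM2l ?expR_ge0// expR_ge1Dx.
have h : p * ln k%:R <= p * (ln k.+1%:R - k.+1%:R^-1) by rewrite ler_wpM2l// ltW.
rewrite ler_expR -subr_ge0.
have -> : - p * ln k%:R - (- p * ln k.+1%:R + p / k.+1%:R) =
  p * (ln k.+1%:R - k.+1%:R^-1) - p * ln k%:R by ring.
by rewrite subr_ge0.
Qed.

Lemma powR_tail (p : R) (J N : nat) : 0 < p -> (0 < J)%N ->
  \sum_(J <= k < N) k.+1%:R `^ (- (p + 1)) <= J%:R `^ (- p) / p.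
Proof.
move=> p0 J0; have [NJ|JN] := leqP N J.
  by rewrite big_geq// divr_ge0 ?powR_ge0// ltW.
rewrite ler_pdivlMr// mulrC mulr_sumr.
apply: (@le_trans _ _ (\sum_(J <= k < N) (k%:R `^ (- p) - k.+1%:R `^ (- p)))).
  apply: ler_sum_nat => k /andP[Jk _]; apply: powR_telescope => //.
  exact: leq_trans Jk.
have -> : \sum_(J <= k < N) (k%:R `^ (- p) - k.+1%:R `^ (- p)) =
   - \sum_(J <= k < N) (k.+1%:R `^ (- p) - k%:R `^ (- p)) :> R.
  by rewrite -sumrN; apply: eq_bigr => k _; rewrite opprB.
by rewrite telescope_sumr ?(ltnW JN)// opprB gerBl powR_ge0.
Qed.

End power_tail.

(** * Orders of magnitude of the weight sums *)

Section weights.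
Context {R : realType} (lam : nat -> R) (s c1 c2 : R).
Hypothesis lam0 : forall k, 0 < lam k.
Hypothesis s12 : 1 / 2 < s.
Hypothesis c10 : 0 < c1.
Hypothesis lam_lb : forall k, c1 <= k.+1%:R `^ (2 * s) * lam k.
Hypothesis lam_ub : forall k, k.+1%:R `^ (2 * s) * lam k <= c2.

Let s0 : 0 < s. Proof. by apply: lt_trans s12; rewrite divr_gt0. Qed.
Let c20 : 0 < c2. Proof. exact: lt_le_trans c10 (le_trans (lam_lb 0) (lam_ub 0)). Qed.
Let p := 2 * s - 1.
Let p0 : 0 < p. Proof. by rewrite /p; have := s12; lra. Qed.

Lemma mweight_01 (rho : R) k : 0 < rho -> 0 <= mweight lam rho k <= 1.
Proof.
move=> r0; have l0 := lam0 k; have r20 : 0 < rho ^+ 2 by rewrite exprn_gt0.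
have lr0 : 0 < lam k + rho ^+ 2 by rewrite addr_gt0.
rewrite /mweight divr_ge0 ?(ltW l0) ?(ltW lr0)//=.
by rewrite ler_pdivrMr// mul1r lerDl ltW.
Qed.

Section fixed_rho.
Variable rho : R.
Hypothesis rho0 : 0 < rho.
(** The effective dimension: eigenvalues of order [k^(-2s)] exceed [rho^2] up to [k] of order
    [D]. *)
Let D := rho `^ (- s^-1).
Let D0 : 0 < D. Proof. exact: powR_gt0. Qed.
Let D2s : D `^ (2 * s) = (rho ^+ 2)^-1.
Proof.
rewrite -powRrM (_ : - s^-1 * (2 * s) = - 2%:R); last by field; rewrite gt_eqF.
by rewrite powR_invn// ltW.
Qed.

Let w_tail k : mweight lam rho k <= c2 * (rho ^+ 2)^-1 * k.+1%:R `^ (- (p + 1)).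
Proof.
have r20 : 0 < rho ^+ 2 by rewrite exprn_gt0.
have l0 := lam0 k.
have -> : - (p + 1) = - (2 * s) by rewrite /p; ring.
have k0 : (0 : R) < k.+1%:R `^ (2 * s) by rewrite powR_gt0.
rewrite powRN /mweight.
apply: (@le_trans _ _ (lam k / rho ^+ 2)).
  by rewrite ler_pM2l// lef_pV2 ?posrE ?addr_gt0// lerDr ltW.
rewrite mulrAC ler_wpM2r ?invr_ge0 ?(ltW r20)//.
by rewrite ler_pdivlMr// mulrC.
Qed.

(** The first [D + 1] weights are at most 1. Beyond them [w_k <= lam k / rho^2], whose tail is at
    most [c2 / p] times [rho^(-2) D^(-p)], and the latter equals [D] because [D^(2s) = rho^(-2)]. *)
Lemma sum_mweight_le N :
  \sum_(0 <= k < N) mweight lam rho k <= (1 + c2 / p) * D + 1.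
Proof.
pose J := (Num.truncn D).+1.
have /andP[DJ1 DJ2] := truncn_itv (ltW D0); rewrite -/J in DJ2.
have w0 k : 0 <= mweight lam rho k by have /andP[] := mweight_01 k rho0.
have w1 k : mweight lam rho k <= 1 by have /andP[] := mweight_01 k rho0.
(* Enlarging the range puts the cut [J] inside it for every [N]. *)
apply: (@le_trans _ _ (\sum_(0 <= k < J + N) mweight lam rho k)).
  rewrite (@big_cat_nat _ _ _ N 0 (J + N))//= ?leq_addl// lerDl sumr_ge0//.
rewrite (@big_cat_nat _ _ _ J 0 (J + N))//= ?leq_addr//.
have h1 : \sum_(0 <= k < J) mweight lam rho k <= D + 1.
  apply: (@le_trans _ _ (\sum_(0 <= k < J) (1 : R))); first exact: ler_sum.
  by rewrite sumr_const_nat subn0 /J -natr1 lerD2r.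
have h2 : \sum_(J <= k < J + N) mweight lam rho k <= c2 / p * D.
  apply: (@le_trans _ _ (c2 * (rho ^+ 2)^-1 * (J%:R `^ (- p) / p))).
    apply: (@le_trans _ _ (\sum_(J <= k < J + N) c2 * (rho ^+ 2)^-1 * k.+1%:R `^ (- (p + 1)))).
      exact: ler_sum.
    rewrite -mulr_sumr ler_wpM2l ?mulr_ge0 ?invr_ge0 ?sqr_ge0 ?(ltW c20)//.
    exact: powR_tail.
  have JD : J%:R `^ (- p) <= D `^ (- p).
    rewrite !powRN lef_pV2 ?posrE ?powR_gt0// ge0_ler_powR ?nnegrE ?ltW//.
  have -> : c2 / p * D = c2 * (rho ^+ 2)^-1 * (D `^ (- p) / p).
    have -> : D `^ (- p) = D * rho ^+ 2.
      have -> : - p = 1 + - (2 * s) by rewrite /p; ring.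
      rewrite powRD ?(gt_eqF D0) ?implybT// powRr1 ?(ltW D0)//.
      by rewrite powRN D2s invrK.
    by field; rewrite !gt_eqF.
  rewrite ler_wpM2l ?mulr_ge0 ?invr_ge0 ?sqr_ge0 ?(ltW c20)//.
  by rewrite ler_wpM2r ?invr_ge0 ?(ltW p0).
by lra.
Qed.

(** As long as [k + 1 <= c1^(1/(2s)) D], the lower bound on the eigenvalues gives [lam k >= rho^2],
    so the weight is at least 1/2 and its square at least 1/4. *)
Lemma sum_mweight_sqr_ge : exists N0, forall N, (N0 <= N)%N ->
  (c1 `^ (2 * s)^-1 * D - 1) / 4 <= \sum_(0 <= k < N) mweight lam rho k ^+ 2.
Proof.
set x := c1 `^ (2 * s)^-1 * D.
have x0 : 0 < x by rewrite mulr_gt0// powR_gt0.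
pose J := Num.truncn x; exists J => N JN.
have /andP[DJ1 DJ2] := truncn_itv (ltW x0); rewrite -/J in DJ1 DJ2.
rewrite (@big_cat_nat _ _ _ J 0 N)//=.
have h0 : 0 <= \sum_(J <= k < N) mweight lam rho k ^+ 2.
  by apply: sumr_ge0 => k _; exact: sqr_ge0.
suff : J%:R / 4 <= \sum_(0 <= k < J) mweight lam rho k ^+ 2.
  by move: DJ2; rewrite -natr1; lra.
have -> : J%:R / 4 = \sum_(0 <= k < J) (2^-1 ^+ 2 : R).
  by rewrite sumr_const_nat subn0 -[RHS]mulr_natl; congr (_ * _); field.
apply: ler_sum_nat => k /andP[_ kJ]; rewrite lerXn2r ?nnegrE ?invr_ge0//.
  by have /andP[] := mweight_01 k rho0.
have kx : k.+1%:R <= x by apply: le_trans DJ1; rewrite ler_nat.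
have r20 : 0 < rho ^+ 2 by rewrite exprn_gt0.
have k0 : (0 : R) < k.+1%:R `^ (2 * s) by rewrite powR_gt0.
have s20 : 0 < 2 * s by rewrite mulr_gt0.
have : k.+1%:R `^ (2 * s) <= c1 * (rho ^+ 2)^-1.
  have := @ge0_ler_powR _ (2 * s) (ltW s20) k.+1%:R x.
  rewrite !nnegrE ler0n (ltW x0) => /(_ isT isT kx) /le_trans; apply.
  rewrite /x powRM ?powR_ge0// ?(ltW D0)// D2s -powRrM mulVf ?gt_eqF//.
  by rewrite powRr1// ltW.
rewrite ler_pdivlMr// => h.
have rl : rho ^+ 2 <= lam k.
  by rewrite -(ler_pM2l k0); apply: le_trans h (lam_lb k).
have l0 := lam0 k.
by rewrite /mweight ler_pdivlMr ?addr_gt0//; lra.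
Qed.

End fixed_rho.
Lemma is_cvg_sum_mweight rho : 0 < rho ->
  cvgn (fun N => \sum_(0 <= k < N) mweight lam rho k).
Proof.
move=> rho0; apply: nondecreasing_is_cvgn.
  apply/nondecreasing_seqP => N; rewrite big_nat_recr//= lerDl.
  by have /andP[] := mweight_01 N rho0.
exists ((1 + c2 / p) * rho `^ (- s^-1) + 1) => _ [N _ <-].
exact: sum_mweight_le.
Qed.

Lemma is_cvg_sum_mweight_sqr rho : 0 < rho ->
  cvgn (fun N => \sum_(0 <= k < N) mweight lam rho k ^+ 2).
Proof.
move=> rho0; apply: nondecreasing_is_cvgn.
  by apply/nondecreasing_seqP => N; rewrite big_nat_recr//= lerDl sqr_ge0.
exists ((1 + c2 / p) * rho `^ (- s^-1) + 1) => _ [N _ <-].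
apply: le_trans (sum_mweight_le rho0 N); apply: ler_sum => k _.
by have /andP[w0 w1] := mweight_01 k rho0; rewrite expr2 ler_piMl.
Qed.

Definition Lw rho : R := limn (fun N => \sum_(0 <= k < N) mweight lam rho k).

Lemma vn_gt0 rho : 0 < rho -> 0 < vn lam rho.
Proof.
move=> rho0; have l0 := lam0 0; have r20 : 0 < rho ^+ 2 by rewrite exprn_gt0.
have w0 : 0 < mweight lam rho 0 ^+ 2 by rewrite exprn_gt0// divr_gt0// addr_gt0.
apply: (lt_le_trans w0); apply: limr_ge; first exact: is_cvg_sum_mweight_sqr.
near=> N; rewrite (big_cat_nat (n := 1))//=; last by near: N; exists 1%N.
by rewrite big_nat1 lerDl sumr_ge0// => k _; exact: sqr_ge0.
Unshelve. all: by end_near. Qed.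

(** With [L <= C D] and [v >= ga D / 8], the last term is at most a constant times [D / n^2], that
    is [(n rho^(1/(2s)))^(-2)]: here the growth condition on [n rho^(1/(2s))] enters. *)
Lemma clt_rate_cvg0 (rho : nat -> R) : (forall n, 0 < rho n) ->
  rho @ \oo --> 0 -> (fun n => n%:R * rho n `^ (2 * s)^-1) @ \oo --> +oo ->
  (fun n => n%:R^-1 + (vn lam (rho n))^-1 +
    Lw (rho n) ^+ 2 / (n%:R ^+ 2 * vn lam (rho n))) @ \oo --> 0.
Proof.
move=> rho0 rho_cvg nrho.
pose ga := c1 `^ (2 * s)^-1; have ga0 : 0 < ga by rewrite powR_gt0.
pose C := 2 + c2 / p; have C0 : 0 < C by rewrite addr_gt0// divr_gt0.
have rs0 : (fun n => rho n `^ s^-1) @ \oo --> 0.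
  apply/cvgrPdist_lt => e e0; move/cvgrPdist_lt : rho_cvg => /(_ (e `^ s) (powR_gt0 _ e0)).
  apply: filterS => n; rewrite !sub0r !normrN !gtr0_norm ?powR_gt0// => h.
  have sn0 : s != 0 by rewrite gt_eqF.
  rewrite -[ltRHS](powRr1 (ltW e0)) -(divff sn0) powRrM.
  by rewrite gt0_ltr_powR ?invr_gt0// nnegrE ltW ?powR_gt0.
have inv0 : (fun n => (n%:R * rho n `^ (2 * s)^-1)^-1) @ \oo --> 0.
  apply/gtr0_cvgV0 => //; near=> n.
  by rewrite mulr_gt0 ?powR_gt0// ltr0n; near: n; exists 1%N.
have n0 : (fun n => n%:R^-1 : R) @ \oo --> 0.
  apply/gtr0_cvgV0; last exact: cvgr_idn.
  by near=> n; rewrite ltr0n; near: n; exists 1%N.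
pose f n := n%:R^-1 + 8 / ga * rho n `^ s^-1
   + 8 * C ^+ 2 / ga * (n%:R * rho n `^ (2 * s)^-1)^-1 ^+ 2 : R.
have f0 : f @ \oo --> 0.
  rewrite (_ : 0 = 0 + 8 / ga * 0 + 8 * C ^+ 2 / ga * (0 * 0) :> R); last by ring.
  apply: cvgD; first apply: cvgD => //.
    by apply: cvgM => //; exact: cvg_cst.
  by apply: cvgM; [exact: cvg_cst|apply: cvgM].
apply: (squeeze_cvgr _ (cvg_cst 0) f0).
near=> n.
have nn : (0 < n)%N by near: n; exists 1%N.
have nr0 : (0 : R) < n%:R by rewrite ltr0n.
have v0 := vn_gt0 (rho0 n).
apply/andP; split.
  rewrite addr_ge0//; first by rewrite addr_ge0// invr_ge0 ltW.
  by rewrite divr_ge0 ?sqr_ge0// mulr_ge0 ?sqr_ge0// ltW.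
pose D := rho n `^ (- s^-1); have D0 : 0 < D by rewrite powR_gt0.
have Dinv : rho n `^ s^-1 = D^-1 by rewrite /D powRN invrK.
(* [D >= 1] absorbs the additive 1 in the bound for [L], and [ga D >= 2] the subtracted 1 in the
   bound for [v]. *)
have hD : D^-1 < Num.min 1 (ga / 2).
  rewrite -Dinv; near: n; apply: cvgr_lt rs0 _ _.
  by rewrite lt_min ltr01/= divr_gt0.
move: hD; rewrite lt_min => /andP[D1 D2].
have {}D1 : 1 <= D by rewrite -[leRHS]invrK invf_ge1 ?invr_gt0// ltW.
have {}D2 : 1 <= ga * D / 2.
  by move: D2; rewrite -(ltr_pM2r D0) mulVf ?gt_eqF// mulrAC => /ltW.
have vD : ga * D / 8 <= vn lam (rho n).
  have [N0 hN] := sum_mweight_sqr_ge (rho0 n).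
  apply: limr_ge; first exact: is_cvg_sum_mweight_sqr.
  near=> N; apply: (@le_trans _ _ ((ga * D - 1) / 4)); first by lra.
  by apply: hN; near: N; exists N0.
have L0 : 0 <= Lw (rho n).
  apply: limr_ge; first exact: is_cvg_sum_mweight.
  near=> N; apply: sumr_ge0 => k _.
  by have /andP[] := mweight_01 k (rho0 n).
have LD : Lw (rho n) <= C * D.
  apply: (@le_trans _ _ ((1 + c2 / p) * D + 1)); last by rewrite /C; lra.
  apply: limr_le; first exact: is_cvg_sum_mweight.
  near=> N; exact: sum_mweight_le.
have gD0 : 0 < ga * D / 8 by rewrite divr_gt0// mulr_gt0.
rewrite /f Dinv; apply: lerD; first (apply: lerD => //).
  have -> : 8 / ga * D^-1 = (ga * D / 8)^-1 by field; rewrite !gt_eqF.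
  by rewrite lef_pV2 ?posrE.
have -> : 8 * C ^+ 2 / ga * (n%:R * rho n `^ (2 * s)^-1)^-1 ^+ 2 =
   (C * D) ^+ 2 / (n%:R ^+ 2 * (ga * D / 8)).
  have -> : D = (rho n `^ (2 * s)^-1) ^- 2.
    rewrite /D -powR_invn ?powR_ge0// -powRrM; congr (_ `^ _).
    by field; rewrite gt_eqF.
  have : 0 < rho n `^ (2 * s)^-1 by rewrite powR_gt0.
  by move=> r0; field; rewrite !gt_eqF.
apply: ler_pM; rewrite ?sqr_ge0 ?invr_ge0 ?mulr_ge0 ?sqr_ge0 ?(ltW v0)//.
  by rewrite lerXn2r ?nnegrE// mulr_ge0 ?ltW.
rewrite lef_pV2 ?posrE ?mulr_gt0 ?exprn_gt0//.
by rewrite ler_wpM2l ?sqr_ge0.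
Unshelve. all: by end_near. Qed.

End weights.

(** * Mean value and Lipschitz estimates *)

Section mean_value.
Context {R : realType}.
Variables f df : R -> R.
Hypothesis fdf : forall x, is_derive x (1 : R) f (df x).

Lemma is_derive_continuous : continuous f.
Proof.
move=> x; have /@ex_derive := fdf x.
by move=> /derivable1_diffP /differentiable_continuous.
Qed.

Lemma mean_value x y : exists2 z, `|z - x| <= `|y - x| & f y - f x = df z * (y - x).
Proof.
have cts a b : {within `[a, b], continuous f}.
  by apply: continuous_subspaceT; exact: is_derive_continuous.
have [xy|yx] := leP x y.
  have [z zxy ->] := MVT_segment xy (fun t _ => fdf t) (cts x y).
  exists z => //; move: zxy; rewrite in_itv/= => /andP[xz zy].
  by rewrite !ger0_norm ?subr_ge0// lerD2r.
have [z zxy h] := MVT_segment (ltW yx) (fun t _ => fdf t) (cts y x).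
exists z; last by rewrite -opprB h -mulrN opprB.
move: zxy; rewrite in_itv/= => /andP[xz zy].
by rewrite distrC (distrC y) !ger0_norm ?subr_ge0 ?(ltW yx)// lerD2l lerN2.
Qed.

Lemma lipschitz_of_derive K : (forall x, `|df x| <= K) ->
  forall x y, `|f y - f x| <= K * `|y - x|.
Proof.
by move=> dfK x y; have [z _ ->] := mean_value x y; rewrite normrM ler_wpM2r.
Qed.

Lemma taylor_of_lipschitz K : (forall x y, `|df y - df x| <= K * `|y - x|) ->
  forall x y, `|f y - f x - (y - x) * df x| <= K * (y - x) ^+ 2.
Proof.
move=> dfK x y; have [z zx ->] := mean_value x y.
have K0 : 0 <= K by have := dfK 0 1; rewrite subr0 normr1 mulr1; exact: le_trans.
rewrite (mulrC (y - x)) -mulrBl normrM -[X in _ <= K * X]real_normK ?num_real//.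
rewrite expr2 mulrA ler_wpM2r// (le_trans (dfK x z))// ler_wpM2l//.
Qed.

End mean_value.

Section lipschitz.
Context {R : realType}.

Lemma lip_continuous (f : R -> R) L : 0 <= L ->
  (forall x y, `|f y - f x| <= L * `|y - x|) -> continuous f.
Proof.
move=> L0 lf x; apply/cvgrPdist_le => e e0; near=> y.
rewrite distrC (le_trans (lf x y))//.
apply: (@le_trans _ _ ((L + 1) * `|x - y|)).
  by rewrite distrC ler_wpM2r// lerDl.
rewrite -ler_pdivlMl ?ltr_wpDl//.
near: y; apply: cvgr_dist_le; first exact: cvg_id.
by rewrite mulr_gt0// invr_gt0 ltr_wpDl.
Unshelve. all: by end_near. Qed.

Lemma lip_supp_bound (f : R -> R) (B L : R) : 0 < B ->
  (forall x y, `|f y - f x| <= L * `|y - x|) ->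
  (forall x, B <= `|x| -> f x = 0) -> forall x, `|f x| <= L * (2 * B).
Proof.
move=> B0 f_lip f_supp x.
have L0 : 0 <= L by have := f_lip 0 1; rewrite subr0 normr1 mulr1; exact: le_trans.
have [xB|xB] := leP B `|x|; first by rewrite f_supp// normr0 mulr_ge0// mulr_ge0// ltW.
have fB : f B = 0 by rewrite f_supp// ger0_norm// ltW.
have := f_lip B x; rewrite fB subr0 => /le_trans; apply.
rewrite ler_wpM2l//; move: xB; rewrite ltr_norml => /andP[? ?].
by rewrite ler_norml; apply/andP; split; lra.
Qed.

End lipschitz.

(** * Stein's equation for the normal law of variance 2 *)

Section stein_equation.
Context {R : realType}.
Notation mu := (@lebesgue_measure R).
Let p : R -> R := normal_pdf 0 (Num.sqrt 2).
Let c0 : R := (2 * normal_peak (Num.sqrt 2))^-1.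
(* [h = 1 / (2 p)] *)
Let h x : R := c0 * expR (x ^+ 2 / 4).

Let s2 : Num.sqrt 2 != 0 :> R.
Proof. by rewrite gt_eqF// sqrtr_gt0. Qed.

Lemma normal_pdf_sqrt2 x : p x = normal_peak (Num.sqrt 2) * expR (- (x ^+ 2 / 4)).
Proof.
rewrite /p normal_pdfE// /normal_fun subr0 sqr_sqrtr// mulNr.
by congr (_ * expR (- (_ / _))); rewrite -mulr_natr -natrM.
Qed.

Let hp x : p x * h x = 1 / 2.
Proof.
rewrite normal_pdf_sqrt2 /h /c0 mulrACA -expRD addNr expR0 mulr1 invfM mulrCA.
by rewrite divff ?mulr1 ?mul1r// gt_eqF// normal_peak_gt0.
Qed.

Let h_ge0 x : 0 <= h x.
Proof. by rewrite mulr_ge0 ?expR_ge0// invr_ge0 mulr_ge0// normal_peak_ge0. Qed.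

Let is_derive_h x : is_derive x (1 : R) h (x / 2 * h x).
Proof.
have d1 : is_derive x (1 : R) (fun y : R => y ^+ 2 / 4) (x / 2).
  rewrite (_ : (fun y => _) = (4^-1 : R) \*: (fun y : R => y ^+ 2)); last first.
    by apply/funext => y /=; rewrite mulrC.
  apply: is_derive_eq; rewrite /GRing.scale/=; lra.
have d2 := @is_derive1_comp _ expR (fun y : R => y ^+ 2 / 4) x _ _ (is_derive_expR _) d1.
have d3 := is_deriveZ c0 d2.
rewrite /h; apply: (is_derive_eq d3); rewrite /GRing.scale/=; ring.
Qed.

Variables (psi : R -> R) (B L : R).
Hypothesis B0 : 0 < B.
Hypothesis psi_lip : forall x y, `|psi y - psi x| <= L * `|y - x|.
Hypothesis psi_supp : forall x, B <= `|x| -> psi x = 0.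
Hypothesis psi_int : \int[mu]_x (psi x * p x) = 0.

Let g x := psi x * p x.
Let C := L * (2 * B).
Let F x := \int[mu]_(t in [set` Interval -oo%O (BRight x)]) g t.
(** Variation of constants: [h' = (x/2) h] and [p h = 1/2]. Since [f'] is defined by the equation
    itself, the content lies in its being the derivative of [f]. *)
Let f x := F x * h x.
Let f' x := (psi x + x * f x) / 2.

Let L0 : 0 <= L.
Proof. by have := psi_lip 0 1; rewrite subr0 normr1 mulr1; exact: le_trans. Qed.

Let psi_bnd x : `|psi x| <= C.
Proof. exact: lip_supp_bound. Qed.

Let psi_cts : continuous psi.
Proof. exact: lip_continuous L0 psi_lip. Qed.

Let p_ge0 x : 0 <= p x. Proof. exact: normal_pdf_ge0. Qed.

Let g_cts : continuous g.
Proof.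
by move=> x; apply: cvgM; [exact: psi_cts|exact: continuous_normal_pdf].
Qed.

Let g_integrable A : measurable A -> mu.-integrable A (EFin \o g).
Proof.
move=> mA; apply: (@integrableS _ _ _ mu setT) => //.
apply: (@le_integrable _ _ _ mu setT measurableT _ (fun x => (C * p x)%:E)).
- by apply/measurable_EFinP; exact: continuous_measurable_fun.
- move=> x _; rewrite lee_fin normrM (ger0_norm (p_ge0 x)).
  apply: le_trans (ler_norm _); exact: ler_wpM2r.
- under eq_fun do rewrite EFinM.
  by apply: integrableZl => //; exact: integrable_normal_pdf.
Qed.

Let is_derive_F x : is_derive x (1 : R) F (g x).
Proof.
have x1 : x < x + 1 by rewrite ltrDl.
have [dF F'] := @continuous_FTC1 _ g -oo%O x (x + 1) x1
  (g_integrable (measurable_itv _)) (ltNyr _) (@g_cts x).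
by apply: DeriveDef => //; rewrite -derive1E.
Qed.

(** To the left of the support nothing has been integrated; to the right [F] is the full Gaussian
    mean of [psi], which vanishes. *)
Let F_supp x : B <= `|x| -> F x = 0.
Proof.
move=> Bx; have [x0|x0] := leP 0 x.
  rewrite -psi_int /F Rintegral_mkcond; apply: eq_Rintegral => y _.
  rewrite patchE; case: ifPn => //; rewrite notin_setE /= in_itv/= => /negP.
  rewrite -ltNge => xy; rewrite psi_supp ?mul0r//.
  move: Bx; rewrite (ger0_norm x0) => /le_trans; apply.
  exact: le_trans (ltW xy) (ler_norm _).
rewrite /F (@eq_Rintegral _ _ _ mu _ (fun=> 0)) ?Rintegral_cst ?mul0r// => y.
rewrite inE/= in_itv/= => yx.
rewrite /g psi_supp ?mul0r//; move: Bx; rewrite (ltr0_norm x0) => /le_trans; apply.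
by rewrite -normrN (le_trans _ (ler_norm _))// lerN2.
Qed.

Let is_derive_f x : is_derive x (1 : R) f (f' x).
Proof.
have := is_deriveM (is_derive_F x) (is_derive_h x).
move=> d; apply: (is_derive_eq d); rewrite /GRing.scale/= /f' /f.
have -> : h x * g x = psi x * (p x * h x) by rewrite /g; ring.
by rewrite hp; field.
Qed.

Let f_supp x : B <= `|x| -> f x = 0.
Proof. by move=> Bx; rewrite /f F_supp// mul0r. Qed.

Let f'_supp x : B <= `|x| -> f' x = 0.
Proof. by move=> Bx; rewrite /f' f_supp// psi_supp// mulr0 addr0 mul0r. Qed.

Lemma stein_solution : exists (f f' : R -> R) (K : R),
  [/\ measurable_fun setT f /\ measurable_fun setT f',
   (forall x, `|f x| <= K) /\ (forall x, `|f' x| <= K),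
   forall x y, `|f y - f x - (y - x) * f' x| <= K * (y - x) ^+ 2,
   forall x y, `|f' y - f' x| <= K * `|y - x| &
   forall x, 2 * f' x - x * f x = psi x].
Proof.
have C_ge0 : 0 <= C by exact: le_trans (psi_bnd 0).
pose G := C * normal_peak (Num.sqrt 2).
have G0 : 0 <= G by rewrite mulr_ge0// normal_peak_ge0.
have gG x : `|g x| <= G.
  rewrite normrM (ger0_norm (p_ge0 x)); apply: ler_pM => //.
  exact: normal_pdf_ub.
(* On the support [|F| <= G (2 B)], since [F] is [G]-Lipschitz and vanishes at [B], while [h] is
   largest at the endpoints. *)
pose K1 := G * (2 * B) * h B.
have B2 : 0 <= 2 * B by rewrite mulr_ge0// ltW.
have K10 : 0 <= K1 by apply: mulr_ge0 => //; apply: mulr_ge0.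
have fK1 x : `|f x| <= K1.
  have [xB|xB] := leP B `|x|; first by rewrite f_supp// normr0.
  rewrite /f normrM (ger0_norm (h_ge0 x)) ler_pM//.
    have FB : F B = 0 by rewrite F_supp// ger0_norm// ltW.
    have := lipschitz_of_derive is_derive_F gG B x.
    rewrite FB subr0 => /le_trans; apply.
    rewrite ler_wpM2l//; move: xB; rewrite ltr_norml => /andP[? ?].
    by rewrite ler_norml; apply/andP; split; lra.
  rewrite /h ler_wpM2l ?invr_ge0 ?mulr_ge0 ?normal_peak_ge0// ler_expR ler_wpM2r//.
  by rewrite -[leLHS]real_normK ?num_real// lerXn2r ?nnegrE ?(ltW B0) ?(ltW xB).
pose K2 := (C + B * K1) / 2.
have K20 : 0 <= K2 by rewrite divr_ge0// addr_ge0// mulr_ge0// ltW.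
have f'K2 x : `|f' x| <= K2.
  have [xB|xB] := leP B `|x|; first by rewrite f'_supp// normr0.
  rewrite /f' normrM (ger0_norm (_ : 0 <= 2^-1))// ler_wpM2r//.
  by rewrite (le_trans (ler_normD _ _))// lerD// normrM ler_pM// ltW.
(* The derivative [f + x f'] is bounded because [f'] vanishes for [|x| >= B]; this makes [f']
   Lipschitz through its defining formula. *)
have xf_lip : forall x y, `|y * f y - x * f x| <= (K1 + B * K2) * `|y - x|.
  apply: (@lipschitz_of_derive _ (fun x => x * f x) (fun x => f x + x * f' x)).
    move=> x; have d := is_deriveM (is_derive_id x (1 : R)) (is_derive_f x).
    by apply: (is_derive_eq d); rewrite /GRing.scale/= mulr1 addrC.
  move=> x; rewrite (le_trans (ler_normD _ _))// lerD// normrM.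
  have [xB|xB] := leP B `|x|; last by rewrite ler_pM// ltW.
  by rewrite f'_supp// normr0 mulr0 mulr_ge0// ltW.
pose K3 := (L + (K1 + B * K2)) / 2.
have BK2 : 0 <= B * K2 by rewrite mulr_ge0// ltW.
have K30 : 0 <= K3 by rewrite divr_ge0// !addr_ge0.
have f'_lip x y : `|f' y - f' x| <= K3 * `|y - x|.
  rewrite /f' -mulrBl normrM (ger0_norm (_ : 0 <= 2^-1))// /K3 [leRHS]mulrAC ler_wpM2r//.
  have -> : psi y + y * f y - (psi x + x * f x) = (psi y - psi x) + (y * f y - x * f x).
    by ring.
  by rewrite mulrDl (le_trans (ler_normD _ _))// lerD.
have f_cts := is_derive_continuous is_derive_f.
have mf : measurable_fun setT f by exact: continuous_measurable_fun.
exists f, f', (K1 + K2 + K3); split.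
- split => //; apply: measurable_funM => //; apply: measurable_funD.
    exact: continuous_measurable_fun.
  by apply: measurable_funM.
- by split=> x; [apply: le_trans (fK1 x) _|apply: le_trans (f'K2 x) _]; lra.
- move=> x y; apply: (@taylor_of_lipschitz _ f f' is_derive_f) => {}x {}y.
  by apply: le_trans (f'_lip x y) _; rewrite ler_wpM2r//; lra.
- move=> x y; apply: le_trans (f'_lip x y) _; rewrite ler_wpM2r//; lra.
- by move=> x; rewrite /f'; field.
Qed.

End stein_equation.

(** * Trapezoidal test functions and their Gaussian means *)

Section trapezoid.
Context {R : realType}.
Implicit Types a b c d e x y : R.

Lemma lip_min a b c d e : `|c - a| <= e -> `|d - b| <= e ->
  `|Num.min c d - Num.min a b| <= e.
Proof.
rewrite !ler_norml => /andP[? ?] /andP[? ?].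
by case: (leP c d); case: (leP a b) => ? ?; apply/andP; split; lra.
Qed.

Lemma lip_max a b c d e : `|c - a| <= e -> `|d - b| <= e ->
  `|Num.max c d - Num.max a b| <= e.
Proof.
rewrite !ler_norml => /andP[? ?] /andP[? ?].
by case: (leP c d); case: (leP a b) => ? ?; apply/andP; split; lra.
Qed.

(** The plateau [[a, b]] has height 1 and the flanks have width [e]; in min-max form the Lipschitz
    constant [1/e] is inherited from the affine pieces. *)
Definition trapezoid a b e x : R :=
  Num.max 0 (Num.min 1 (Num.min (1 + (x - a) / e) (1 + (b - x) / e))).

Lemma trapezoid_ge0 a b e x : 0 <= trapezoid a b e x.
Proof. by rewrite le_max lexx. Qed.

Lemma trapezoid_le1 a b e x : trapezoid a b e x <= 1.
Proof. by rewrite ge_max ler01 ge_min lexx. Qed.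

Lemma trapezoid_lip a b e x y : 0 < e ->
  `|trapezoid a b e y - trapezoid a b e x| <= e^-1 * `|y - x|.
Proof.
move=> e0; have ei : 0 <= e^-1 by rewrite invr_ge0 ltW.
have D : `|y - x| / e = `|(y - x) / e| by rewrite normrM (ger0_norm ei).
rewrite mulrC D /trapezoid; apply: lip_max; first by rewrite subrr normr0.
apply: lip_min; first by rewrite subrr normr0.
apply: lip_min.
  by rewrite le_eqVlt; apply/orP; left; apply/eqP; congr `|_|; ring.
by rewrite -normrN le_eqVlt; apply/orP; left; apply/eqP; congr `|_|; ring.
Qed.

Lemma trapezoid_eq1 a b e x : 0 < e -> a <= x <= b -> trapezoid a b e x = 1.
Proof.
move=> e0 /andP[ax xb]; have ei : 0 <= e^-1 by rewrite invr_ge0 ltW.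
rewrite /trapezoid min_l ?max_r// le_min.
by rewrite !lerDl !mulr_ge0// subr_ge0.
Qed.

Lemma trapezoid_supp a b e x : 0 < e -> trapezoid a b e x != 0 ->
  a - e < x < b + e.
Proof.
move=> e0; apply: contraR; rewrite negb_and -!leNgt => h.
apply/eqP; apply: max_l; rewrite !ge_min; apply/orP; right.
by case/orP: h => h; apply/orP; [left|right];
  rewrite -(ler_pM2r e0) mul0r mulrDl mul1r mulfVK ?gt_eqF//; lra.
Qed.

Lemma trapezoid_continuous a b e : 0 < e -> continuous (trapezoid a b e).
Proof.
move=> e0; apply: (@lip_continuous _ _ e^-1); first by rewrite invr_ge0 ltW.
by move=> x y; exact: trapezoid_lip.
Qed.

End trapezoid.

Section gauss_mean.
Context {R : realType}.
Notation mu := (@lebesgue_measure R).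
Local Notation p := (normal_pdf 0 (Num.sqrt 2) : R -> R).
Local Notation N01 := (normal_prob (0 : R) (Num.sqrt 2)).

Lemma gauss_integrable (g : R -> R) K : continuous g -> (forall x, `|g x| <= K) ->
  mu.-integrable setT (EFin \o (fun x => g x * p x)).
Proof.
move=> cg gK.
have s2 : Num.sqrt 2 != 0 :> R by rewrite gt_eqF// sqrtr_gt0.
apply: (@le_integrable _ _ _ mu setT measurableT _ (fun x => (K * p x)%:E)).
- apply/measurable_EFinP; apply: measurable_funM.
    exact: continuous_measurable_fun.
  exact: measurable_normal_pdf.
- move=> x _; rewrite lee_fin normrM (ger0_norm (normal_pdf_ge0 _ _ _)).
  by apply: le_trans (ler_norm _); rewrite ler_wpM2r// normal_pdf_ge0.
- under eq_fun do rewrite EFinM.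
  by apply: integrableZl => //; exact: integrable_normal_pdf.
Qed.

Lemma gauss_mean1 : \int[mu]_x p x = 1.
Proof. by rewrite /Rintegral integral_normal_pdf. Qed.

Lemma gauss_mean_le1 (g : R -> R) : continuous g -> (forall x, 0 <= g x <= 1) ->
  0 <= \int[mu]_x (g x * p x) <= 1.
Proof.
move=> cg g01; have gK x : `|g x| <= 1.
  by have /andP[? ?] := g01 x; rewrite ger0_norm.
apply/andP; split.
  apply: Rintegral_ge0 => x _; have /andP[? ?] := g01 x.
  by rewrite mulr_ge0// normal_pdf_ge0.
rewrite -[leRHS]gauss_mean1; apply: le_Rintegral => //.
- exact: gauss_integrable cg gK.
- exact: integrable_normal_pdf.
- move=> x _; have /andP[? ?] := g01 x.
  by rewrite ler_piMl// normal_pdf_ge0.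
Qed.

Lemma gauss_mean_ge (g : R -> R) A : continuous g -> (forall x, 0 <= g x <= 1) ->
  measurable A -> (forall x, A x -> g x = 1) ->
  fine (N01 A) <= \int[mu]_x (g x * p x).
Proof.
move=> cg g01 mA gA; have gK x : `|g x| <= 1.
  by have /andP[? ?] := g01 x; rewrite ger0_norm.
have -> : fine (N01 A) = \int[mu]_(x in A) p x by [].
rewrite Rintegral_mkcond; apply: le_Rintegral => //.
- rewrite -restrict_EFin -integrable_mkcond//.
  by apply: (@integrableS _ _ _ mu setT) => //; exact: integrable_normal_pdf.
- exact: gauss_integrable cg gK.
- move=> x _; rewrite patchE; case: ifPn => [|_].
    by rewrite inE => Ax; rewrite gA// mul1r.
  by have /andP[? ?] := g01 x; rewrite mulr_ge0// normal_pdf_ge0.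
Qed.

End gauss_mean.

(** * From Stein's equation to distribution functions *)

Section clt.
Context {R : realType} {dO : measure_display} {Omega : measurableType dO}
  (P : probability Omega R) (W : nat -> Omega -> R).
Notation mu := (@lebesgue_measure R).
Local Notation p := (normal_pdf 0 (Num.sqrt 2) : R -> R).
Local Notation N01 := (normal_prob (0 : R) (Num.sqrt 2)).
Local Notation E := (Rintegral P setT).
Hypothesis mW : forall n, measurable_fun setT (W n).
Hypothesis W_stein : forall (psi : R -> R) (B L : R), 0 < B ->
  (forall x y, `|psi y - psi x| <= L * `|y - x|) ->
  (forall x, B <= `|x| -> psi x = 0) ->
  \int[mu]_x (psi x * p x) = 0 ->
  E (fun w => psi (W n w)) @[n --> \oo] --> 0.
(** Chebyshev's inequality for a second moment at most 2, stated through bounded continuous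
    functions because those pass to the limit in the truncation. *)
Hypothesis W_tight : forall (chi : R -> R) (B : R), continuous chi ->
  (forall x, 0 <= chi x <= 1) -> 0 < B -> (forall x, 1 - x ^+ 2 / B ^+ 2 <= chi x) ->
  \forall n \near \oo, 1 - 2 / B ^+ 2 <= E (fun w => chi (W n w)).

Lemma ex_trapezoid_ge a b e eps : 0 < e -> 0 < eps ->
  \forall n \near \oo,
    fine (N01 `[a, b]) - eps <= E (fun w => trapezoid a b e (W n w)).
Proof.
move=> e0 eps0; pose g := trapezoid a b e.
have cg : continuous g by exact: trapezoid_continuous.
have g01 x : 0 <= g x <= 1 by rewrite trapezoid_ge0 trapezoid_le1.
(* Makes [2 / B^2 <= eps / 2], since [B^2 >= B] and [(eps / 2) B >= 2]. *)
pose B : R := 1 + 4 / eps.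
have B1 : 1 <= B by rewrite lerDl divr_ge0// ltW.
have B0 : 0 < B by exact: lt_le_trans B1.
have B2 : 2 / B ^+ 2 <= eps / 2.
  have B20 : 0 < B ^+ 2 by rewrite exprn_gt0.
  rewrite ler_pdivrMr// (@le_trans _ _ (eps / 2 * B))//.
    rewrite /B mulrDr mulr1 (_ : eps / 2 * (4 / eps) = 2); last by field; rewrite gt_eqF.
    by rewrite lerDr divr_ge0// ltW.
  by rewrite ler_wpM2l ?divr_ge0 ?(ltW eps0)// ler_eXnr.
pose chi := trapezoid (- B) B 1.
have cchi : continuous chi by exact: trapezoid_continuous.
have chi01 x : 0 <= chi x <= 1 by rewrite trapezoid_ge0 trapezoid_le1.
have chiB x : 1 - x ^+ 2 / B ^+ 2 <= chi x.
  have [xB|xB] := leP `|x| B.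
    rewrite /chi trapezoid_eq1// -?ler_norml// gerBl divr_ge0// sqr_ge0//.
  apply: le_trans (proj1 (andP (chi01 x))); rewrite subr_le0.
  rewrite ler_pdivlMr ?exprn_gt0// mul1r -[leRHS]real_normK ?num_real//.
  by rewrite lerXn2r ?nnegrE ?(ltW B0) ?(ltW xB).
pose Ng := \int[mu]_x (g x * p x); pose Nc := \int[mu]_x (chi x * p x).
have /andP[Ng0 Ng1] : 0 <= Ng <= 1 by exact: gauss_mean_le1.
have /andP[Nc0 Nc1] : 0 <= Nc <= 1 by exact: gauss_mean_le1.
have gA : fine (N01 `[a, b]) <= Ng.
  apply: gauss_mean_ge => // x; rewrite /= in_itv/= => xab.
  exact: trapezoid_eq1.
(* The Gaussian mean of [psi] vanishes, so that [Nc * E g] and [Ng * E chi] are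
   asymptotically equal; tightness bounds [E chi] from below. *)
pose psi x := Nc * g x - Ng * chi x.
have bg x : `|g x| <= 1 by rewrite ger0_norm ?trapezoid_ge0// trapezoid_le1.
have bc x : `|chi x| <= 1 by rewrite ger0_norm ?trapezoid_ge0// trapezoid_le1.
(* Covers the supports of both bumps, [[a - e, b + e]] and [[- B - 1, B + 1]]. *)
pose B' : R := 1 + `|a| + `|b| + e + B.
have na := normr_ge0 a; have nb := normr_ge0 b.
have la := ler_norm a; have lb := ler_norm b.
have la' := ler_norm (- a); have lb' := ler_norm (- b).
rewrite !normrN in la' lb'.
have psi0 : E (fun w => psi (W n w)) @[n --> \oo] --> 0.
  apply: (W_stein (B := B') (L := e^-1 + 1)).
  - by rewrite /B'; lra.
  - move=> x y; rewrite /psi.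
    have -> : Nc * g y - Ng * chi y - (Nc * g x - Ng * chi x) =
      Nc * (g y - g x) - Ng * (chi y - chi x) by ring.
    rewrite (le_trans (ler_normB _ _))// mulrDl lerD// normrM ger0_norm//.
      by rewrite (le_trans _ (trapezoid_lip a b x y e0))// ler_piMl.
    by have := trapezoid_lip (- B) B x y ltr01; rewrite invr1; apply: le_trans; rewrite ler_piMl.
  - move=> x; rewrite /B' => Bx; rewrite /psi.
    have -> : g x = 0.
      apply/eqP; apply: contraLR Bx => /(trapezoid_supp e0) /andP[? ?].
      by rewrite -ltNge ltr_norml; apply/andP; split; lra.
    have -> : chi x = 0; last by rewrite !mulr0 subrr.
    apply/eqP; apply: contraLR Bx => /(trapezoid_supp ltr01) /andP[? ?].
    by rewrite -ltNge ltr_norml; apply/andP; split; lra.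
  - have iZ k (u : R -> R) : mu.-integrable setT (EFin \o u) ->
        mu.-integrable setT (EFin \o (fun x => k * u x)).
      by move=> iu; rewrite /comp; under eq_fun do rewrite EFinM; exact: integrableZl.
    have ig := gauss_integrable cg bg; have ic := gauss_integrable cchi bc.
    transitivity (\int[mu]_x (Nc * (g x * p x)) - \int[mu]_x (Ng * (chi x * p x))).
      rewrite -RintegralB//; [|exact: iZ|exact: iZ].
      by apply: eq_Rintegral => x _; rewrite /psi; ring.
    by rewrite !RintegralZl// -/Ng -/Nc mulrC subrr.
have bmg n : bmeas (fun w => g (W n w)).
  by apply: (bmeas_comp _ bg) => //; exact: continuous_measurable_fun.
have bmc n : bmeas (fun w => chi (W n w)).
  by apply: (bmeas_comp _ bc) => //; exact: continuous_measurable_fun.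
have e20 : 0 < eps / 2 by rewrite divr_gt0.
have h1 := cvgr_gt _ psi0 _ (_ : - (eps / 2) < 0).
near=> n.
have : - (eps / 2) < E (fun w => psi (W n w)) by near: n; apply: h1; rewrite oppr_lt0.
have -> : E (fun w => psi (W n w)) = Nc * E (fun w => g (W n w)) - Ng * E (fun w => chi (W n w)).
  by rewrite -!exZ// -exB//; bm.
have : 1 - 2 / B ^+ 2 <= E (fun w => chi (W n w)) by near: n; exact: W_tight.
move=> h2 h3.
have Eg0 : 0 <= E (fun w => g (W n w)) by apply: ex_ge0 => w; exact: trapezoid_ge0.
have h4 : Nc * E (fun w => g (W n w)) <= E (fun w => g (W n w)) by rewrite ler_piMl.
have h5 : Ng * (1 - eps / 2) <= Ng * E (fun w => chi (W n w)).
  by rewrite ler_wpM2l//; lra.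
have h6 : Ng * (eps / 2) <= eps / 2 by rewrite ler_piMl// ltW.
(* The chain is [E g >= Nc E g > Ng E chi - eps/2 >= Ng - eps], using that [Nc] and [Ng] lie in
   [[0, 1]]. *)
rewrite -/g; lra.
Unshelve. all: by end_near. Qed.

(** The lower half of the portmanteau theorem: [U] is exhausted by intervals whose trapezoids still
    live inside [U], and one of them carries almost all the Gaussian mass of [U]. *)
Lemma prob_liminf (U : set R) (al be e : nat -> R) eps : measurable U -> 0 < eps ->
  (forall k, 0 < e k) ->
  (forall i j, (i <= j)%N -> `[al i, be i]%classic `<=` `[al j, be j]%classic) ->
  \bigcup_k `[al k, be k]%classic = U ->
  (forall k x, al k - e k < x < be k + e k -> U x) ->
  \forall n \near \oo, fine (N01 U) - eps <= fine (P (W n @^-1` U)).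
Proof.
move=> mU eps0 e0 nd UE sub.
have /cvgrPdist_lt : fine (N01 `[al k, be k]) @[k --> \oo] --> fine (N01 U).
  apply: fine_cvg; rewrite fineK ?fin_num_measure// -UE.
  apply: nondecreasing_cvg_mu => //.
    by apply: bigcup_measurable => k _.
  by move=> i j ij; apply/subsetPset; exact: nd.
have e20 : 0 < eps / 2 by rewrite divr_gt0.
move=> /(_ _ e20) [k _ /(_ k (leqnn k))] /= hk.
have := @ex_trapezoid_ge (al k) (be k) _ _ (e0 k) e20.
apply: filterS => n hn.
have mUn : measurable (W n @^-1` U) by rewrite -[X in measurable X]setTI; exact: mW.
have -> : fine (P (W n @^-1` U)) = E (\1_(W n @^-1` U)).
  by rewrite /Rintegral integral_indic// setIT.
have bI : bmeas (\1_(W n @^-1` U) : Omega -> R).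
  split; first exact: measurable_indic.
  by exists 1 => w; rewrite indicE; case: (_ \in _); rewrite ?normr1 ?normr0.
apply: (@le_trans _ _ (E (fun w => trapezoid (al k) (be k) (e k) (W n w)))).
  by move: hk; rewrite ltr_norml => /andP[? ?]; lra.
apply: ex_le => //.
  apply: (@bmeas_comp _ _ _ (trapezoid (al k) (be k) (e k)) (W n) 1) => //.
    by apply: continuous_measurable_fun; exact: trapezoid_continuous.
  by move=> x; rewrite ger0_norm ?trapezoid_ge0// trapezoid_le1.
move=> w; rewrite indicE; have [_|wU] := boolP (w \in _); first by rewrite trapezoid_le1.
rewrite leNgt; apply: contra wU => h; rewrite inE; apply: (sub k).
by apply: trapezoid_supp => //; rewrite gt_eqF.
Qed.

Lemma normal_prob_set1 (t : R) : N01 [set t] = 0%E.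
Proof. by rewrite /normal_prob integral_set1. Qed.

(** Lower bounds suffice: applied to []-oo, t[] and []t, +oo[] they bound the distribution function
    from both sides, and the two half-lines share the full mass because the Gaussian law has no atom
    at [t]. *)
Lemma cdf_cvg (t : R) :
  fine (P [set w | W n w <= t]) @[n --> \oo] --> fine (N01 `]-oo, t]).
Proof.
pose e k : R := k.+1%:R^-1.
have e0 k : 0 < e k by rewrite invr_gt0 ltr0n.
have e_noninc : {homo e : i j / (i <= j)%N >-> j <= i}.
  by move=> i j ij; rewrite lef_pV2 ?posrE ?ltr0n// ler_nat ltnS.
(* One [k] beyond [d + 1/d] serves the end near [t] and the end near infinity together. *)
have big_k d : 0 < d -> exists k, e k <= d /\ d <= k.+1%:R.
  move=> d0; pose k := `|Num.ceil (d + d^-1)|%N; exists k.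
  have dk : d + d^-1 <= k.+1%:R.
    rewrite (le_trans (Num.Theory.ceil_ge _))// -natr1 -[leLHS]addr0 lerD//.
    by rewrite natr_absz ler_int ler_norm.
  have di : 0 < d^-1 by rewrite invr_gt0.
  split; last by lra.
  by rewrite /e -[leRHS]invrK lef_pV2 ?posrE ?ltr0n//; lra.
have fP A : measurable A -> fine (P (~` A)) = 1 - fine (P A).
  by move=> mA; rewrite probability_setC// fineB// ?fin_num_measure.
have fN A : measurable A -> fine (N01 (~` A)) = 1 - fine (N01 A).
  by move=> mA; rewrite probability_setC// fineB// ?fin_num_measure.
have mWU n (U : set R) : measurable U -> measurable (W n @^-1` U).
  by move=> mU; rewrite -[X in measurable X]setTI; exact: mW.
have No : N01 `]-oo, t[ = N01 `]-oo, t].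
  have -> : `]-oo, t]%classic = `]-oo, t[%classic `|` [set t].
    apply/seteqP; split => x /=; rewrite !in_itv/=.
      by rewrite le_eqVlt => /predU1P[->|]; [right|left].
    by case=> [/ltW//|->].
  rewrite measureU//=; last first.
    by apply/seteqP; split => // x /=; rewrite in_itv/= => -[xt xE]; move: xt; rewrite xE ltxx.
  by rewrite [X in (_ + X)%E]normal_prob_set1 adde0.
apply/cvgrPdist_le => eps eps0.
have lo : \forall n \near \oo, fine (N01 `]-oo, t[) - eps <= fine (P (W n @^-1` `]-oo, t[)).
  (* The flank of width [e k] starts at [t - e k] and reaches zero exactly at [t], hence stays in
     the open half-line. *)
  apply: (@prob_liminf _ (fun k => t - k.+1%:R) (fun k => t - e k) e) => //.
  - move=> i j ij x; rewrite /= !in_itv/= => /andP[h1 h2]; have := e_noninc _ _ ij.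
    have : i.+1%:R <= j.+1%:R :> R by rewrite ler_nat ltnS.
    by move=> *; apply/andP; split; lra.
  - apply/seteqP; split => x.
      by move=> [k _] /=; rewrite !in_itv/= => /andP[_]; have := e0 k; lra.
    rewrite /= in_itv/= => xt; have tx : 0 < t - x by rewrite subr_gt0.
    have [k [h1 h2]] := big_k _ tx.
    by exists k => //=; rewrite in_itv/=; apply/andP; split; lra.
  - by move=> k x /andP[_]; rewrite /= in_itv/=; lra.
have hi : \forall n \near \oo, fine (N01 `]t, +oo[) - eps <= fine (P (W n @^-1` `]t, +oo[)).
  apply: (@prob_liminf _ (fun k => t + e k) (fun k => t + k.+1%:R) e) => //.
  - move=> i j ij x; rewrite /= !in_itv/= => /andP[h1 h2]; have := e_noninc _ _ ij.
    have : i.+1%:R <= j.+1%:R :> R by rewrite ler_nat ltnS.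
    by move=> *; apply/andP; split; lra.
  - apply/seteqP; split => x.
      by move=> [k _] /=; rewrite !in_itv/= andbT => /andP[+ _]; have := e0 k; lra.
    rewrite /= in_itv/= andbT => xt; have tx : 0 < x - t by rewrite subr_gt0.
    have [k [h1 h2]] := big_k _ tx.
    by exists k => //=; rewrite in_itv/=; apply/andP; split; lra.
  - by move=> k x /andP[+ _]; rewrite /= in_itv/= andbT; lra.
near=> n.
have h1 : fine (N01 `]-oo, t[) - eps <= fine (P (W n @^-1` `]-oo, t[)) by near: n.
have h2 : fine (N01 `]t, +oo[) - eps <= fine (P (W n @^-1` `]t, +oo[)) by near: n.
have -> : [set w | W n w <= t] = W n @^-1` `]-oo, t].
  by apply/seteqP; split => w; rewrite /= in_itv.
have h3 : fine (P (W n @^-1` `]-oo, t[)) <= fine (P (W n @^-1` `]-oo, t])).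
  rewrite fine_le ?fin_num_measure//; try by apply: mWU.
  apply: le_measure; rewrite ?inE; try by apply: mWU.
  by move=> w; rewrite /= !in_itv/=; exact: ltW.
move: h1; rewrite No => h1.
have mle : measurable (W n @^-1` `]-oo, t]) by apply: mWU; exact: measurable_itv.
move: h2; rewrite -setCitvl preimage_setC (fP _ mle) (fN _ (measurable_itv _)).
move=> h2; rewrite ler_norml; apply/andP; split; lra.
Unshelve. all: by end_near. Qed.

End clt.

(** * Bounded convergence and the limit in the truncation *)

Section bounded_convergence.
Context {R : realType} {d : measure_display} {T : measurableType d}
  (P : probability T R).
Local Notation E := (Rintegral P setT).

Lemma ex_cvg (Z_ : nat -> T -> R) (Z : T -> R) K :
  (forall N, measurable_fun setT (Z_ N)) -> (forall N w, `|Z_ N w| <= K) ->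
  (forall w, Z_ N w @[N --> \oo] --> Z w) -> E (Z_ N) @[N --> \oo] --> E Z.
Proof.
move=> mZ_ ZK cZ.
have mZ : measurable_fun setT Z by apply: (measurable_fun_cvg mZ_) => w _; exact: cZ.
have bK : bmeas (fun _ : T => K) by exact: bmeas_cst.
have [|||||iZ _ cv] := @dominated_convergence _ _ _ P setT measurableT
  (fun N w => (Z_ N w)%:E) (fun w => (Z w)%:E) (fun=> K%:E).
- by move=> N; exact/measurable_EFinP.
- exact/measurable_EFinP.
- by apply: aeW => w _; apply: cvg_EFin; [exact: nearW|exact: cZ].
- exact: (bmeas_integrable P bK).
- by apply: aeW => w N _ /=; rewrite lee_fin.
apply: fine_cvg; rewrite fineK//.
exact: integrable_fin_num.
Qed.

End bounded_convergence.

(** * The statistic as a limit of truncated quadratic forms *)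

Section statistic.
Context {R : realType} {dO d : measure_display} {Omega : measurableType dO}
  {T : measurableType d} (P : probability Omega R) (P0 : probability T R)
  (X : nat -> Omega -> T) (phi : nat -> T -> R) (lam : nat -> R) (M rho : R).
Hypothesis M1 : 1 <= M.
Hypothesis phiM : forall k x, `|phi k x| <= M.
Hypothesis w01 : forall k, 0 <= mweight lam rho k <= 1.
Hypothesis cvg_w : cvgn (fun N => \sum_(0 <= k < N) mweight lam rho k).
Hypothesis cvg_w2 : cvgn (fun N => \sum_(0 <= k < N) mweight lam rho k ^+ 2).
Hypothesis vn0 : 0 < vn lam rho.
Variable n : nat.
Hypothesis n0 : (0 < n)%N.
Local Notation w := (mweight lam rho).
Local Notation E := (Rintegral P setT).

(** Normalised by the truncated [vsum w N] rather than by [vn], so that [c^2 n^2 vsum = 1] holds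
    exactly as soon as [vsum w N] is positive. *)
Definition statN N om : R :=
  (Num.sqrt (vsum w N))^-1 / n%:R * Usum X phi w N (iota 0 n) om.
Definition stat om : R := (Num.sqrt (vn lam rho))^-1 *
  (n%:R * eta2 lam phi rho n (fun i => X i om) - An lam phi rho n (fun i => X i om)).

Let w0 k : 0 <= w k. Proof. by have /andP[] := w01 k. Qed.

Lemma is_cvg_weighted (b : nat -> R) C : (forall k, 0 <= b k <= C) ->
  cvgn (fun N => \sum_(0 <= k < N) w k * b k).
Proof.
move=> bC; apply: nondecreasing_is_cvgn.
  apply/nondecreasing_seqP => N; rewrite big_nat_recr//= lerDl.
  by have /andP[b0 _] := bC N; exact: mulr_ge0.
have C0 : 0 <= C by have /andP[b0] := bC 0%N; exact: le_trans.
exists (C * limn (fun N => \sum_(0 <= k < N) w k)) => _ [N _ <-].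
apply: (@le_trans _ _ (C * \sum_(0 <= k < N) w k)).
  rewrite mulr_sumr; apply: ler_sum => k _; rewrite mulrC.
  by have /andP[_ bk] := bC k; rewrite ler_wpM2r.
rewrite ler_wpM2l//; apply: (nondecreasing_cvgn_le _ cvg_w).
by apply/nondecreasing_seqP => m; rewrite big_nat_recr//= lerDl.
Qed.

(** At each finite [N], subtracting the truncation of [An] removes precisely the diagonal terms
    [i = j]. Both series converge pointwise because the weights are summable and the [phi k]
    uniformly bounded. *)
Lemma statN_cvg om : statN N om @[N --> \oo] --> stat om.
Proof.
have nR0 : (0 : R) < n%:R by rewrite ltr0n.
have M0 : 0 <= M by exact: le_trans M1.
pose e N : R := \sum_(0 <= k < N) (w k * ((n%:R)^-1 * \sum_(i < n) phi k (X i om)) ^+ 2).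
pose t x N : R := \sum_(0 <= k < N) (w k * phi k x * phi k x).
have ce : e @ \oo --> eta2 lam phi rho n (fun i => X i om).
  apply: (@is_cvg_weighted (fun k => ((n%:R)^-1 * \sum_(i < n) phi k (X i om)) ^+ 2) (M ^+ 2)).
  move=> k; rewrite sqr_ge0/= -[leLHS]real_normK ?num_real//.
  rewrite lerXn2r ?nnegrE// normrM ger0_norm ?invr_ge0 ?(ltW nR0)//.
  rewrite ler_pdivrMl// (le_trans (ler_norm_sum _ _ _))//.
  apply: (@le_trans _ _ (\sum_(i < n) M)); first exact: ler_sum.
  by rewrite sumr_const card_ord mulr_natl.
have ct x : t x @ \oo --> Ktilde lam phi rho x x.
  have -> : t x = (fun N => \sum_(0 <= k < N) w k * (phi k x) ^+ 2).
    by apply/funext => N; apply: eq_bigr => k _; rewrite -mulrA expr2.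
  rewrite /Ktilde (_ : (fun N => \sum_(0 <= k < N) w k * phi k x * phi k x) =
    (fun N => \sum_(0 <= k < N) w k * (phi k x) ^+ 2)); last first.
    by apply/funext => N; apply: eq_bigr => k _; rewrite -mulrA expr2.
  apply: (@is_cvg_weighted (fun k => (phi k x) ^+ 2) (M ^+ 2)).
  move=> k; rewrite sqr_ge0/= -[leLHS]real_normK ?num_real//.
  by rewrite lerXn2r ?nnegrE.
have cs : (Num.sqrt (vsum w N))^-1 @[N --> \oo] --> (Num.sqrt (vn lam rho))^-1.
  apply: cvgV; first by rewrite gt_eqF// sqrtr_gt0.
  by apply: continuous_cvg => //; exact: sqrt_continuous.
have -> : (fun N => statN N om) = (fun N => (Num.sqrt (vsum w N))^-1 *
    (n%:R * e N - n%:R^-1 * \sum_(i < n) t (X i om) N)).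
  apply/funext => N; rewrite /statN -mulrA; congr (_ * _).
  rewrite /Usum mulr_sumr /e mulr_sumr /t exchange_big/= mulr_sumr -sumrB.
  apply: eq_bigr => k _; rewrite /Tsum.
  have iE (F : nat -> R) : \sum_(j <- iota 0 n) F j = \sum_(i < n) F i.
    by rewrite -[RHS](big_mkord xpredT) /index_iota subn0.
  rewrite !iE.
  have -> : \sum_(i < n) w k * phi k (X i om) * phi k (X i om) =
    w k * \sum_(i < n) phi k (X i om) ^+ 2.
    by rewrite mulr_sumr; apply: eq_bigr => i _; rewrite -mulrA expr2.
  by field; rewrite gt_eqF.
apply: cvgM => //; apply: cvgB; first by apply: cvgM => //; exact: cvg_cst.
apply: cvgM; first exact: cvg_cst.
elim: (index_enum _) => [|i r IH].
  by rewrite big_nil; under eq_fun do rewrite big_nil; exact: cvg_cst.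
by rewrite big_cons; under eq_fun do rewrite big_cons; apply: cvgD.
Qed.

Hypothesis XI : iid P P0 X.
Hypothesis mphi : forall k, measurable_fun setT (phi k).

Lemma bmeas_statN N : bmeas (statN N).
Proof. by apply: bmeas_W; [exact: XI|exact: mphi|exact: phiM]. Qed.

Lemma measurable_stat : measurable_fun setT stat.
Proof.
apply: (measurable_fun_cvg (h := statN)) => [N|om _]; last exact: statN_cvg.
by have [] := bmeas_statN N.
Qed.

Lemma ex_statN_cvg (psi : R -> R) K : continuous psi -> (forall x, `|psi x| <= K) ->
  E (fun om => psi (statN N om)) @[N --> \oo] --> E (fun om => psi (stat om)).
Proof.
move=> cpsi pK; apply: (@ex_cvg _ _ _ P _ _ K) => // [N|om].
  apply: measurableT_comp; first exact: continuous_measurable_fun.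
  by have [] := bmeas_statN N.
by apply: continuous_cvg; [exact: cpsi|exact: statN_cvg].
Qed.

Local Notation E0 := (Rintegral P0 setT).
Hypothesis phi0 : forall k, E0 (phi k) = 0.
Hypothesis phi_orth : forall j k, E0 (fun x => phi j x * phi k x) = (j == k)%:R.

Let near_norm : \forall N \near \oo,
  ((Num.sqrt (vsum w N))^-1 / n%:R) ^+ 2 * (n%:R ^+ 2 * vsum w N) = 1.
Proof.
near=> N.
have v0 : 0 < vsum w N by near: N; apply: (cvgr_gt _ cvg_w2 _ vn0).
rewrite exprMn exprVn sqr_sqrtr ?ltW//.
by field; rewrite !gt_eqF// ltr0n.
Unshelve. all: by end_near. Qed.

Lemma stat_tight (chi : R -> R) (B : R) : continuous chi ->
  (forall x, 0 <= chi x <= 1) -> 0 < B -> (forall x, 1 - x ^+ 2 / B ^+ 2 <= chi x) ->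
  1 - 2 / B ^+ 2 <= E (fun om => chi (stat om)).
Proof.
move=> cchi chi01 B0 chiB.
have bc x : `|chi x| <= 1 by have /andP[? ?] := chi01 x; rewrite ger0_norm.
apply: (ler_cvg_to (cvg_cst _) (ex_statN_cvg cchi bc)).
near=> N.
have cv : ((Num.sqrt (vsum w N))^-1 / n%:R) ^+ 2 * (n%:R ^+ 2 * vsum w N) = 1 by near: N.
have bW := bmeas_statN N.
have bcW : bmeas (fun om => chi (statN N om)).
  by apply: (bmeas_comp _ bc); [exact: continuous_measurable_fun|have [] := bW].
have W2 : E (fun om => statN N om ^+ 2) <= 2.
  exact: (ex_W2_le XI mphi phiM phi0 phi_orth n0 cv).
apply: (@le_trans _ _ (E (fun om => 1 - (B ^+ 2)^-1 * statN N om ^+ 2))).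
  rewrite exB; [|by bm|by bm]; rewrite ex_cst exZ; last by bm.
  by rewrite lerD2l lerN2 mulrC ler_wpM2r// invr_ge0 sqr_ge0.
by apply: ex_le => [| |om]; [by bm|by bm|rewrite mulrC].
Unshelve. all: by end_near. Qed.

(** The two Stein terms are recombined into [psi], which is continuous and bounded, before [N] is
    sent to infinity; on the right only [stein_rate] depends on [N]. *)
Lemma stat_stein (psi f f' : R -> R) (K K' a : R) : continuous psi ->
  (forall x, `|psi x| <= K') ->
  measurable_fun setT f -> measurable_fun setT f' ->
  (forall x, `|f x| <= K) -> (forall x, `|f' x| <= K) ->
  (forall x y, `|f y - f x - (y - x) * f' x| <= K * (y - x) ^+ 2) ->
  (forall x y, `|f' y - f' x| <= K * `|y - x|) ->
  (forall x, 2 * f' x - x * f x = psi x) -> 0 < a <= 1 ->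
  `|E (fun om => psi (stat om))| <= K * (10 * a + 42 * M ^+ 6 *
    (n%:R^-1 + (vn lam rho)^-1 + Lw lam rho ^+ 2 / (n%:R ^+ 2 * vn lam rho)) / a).
Proof.
move=> cpsi psiK mf mf' fK f'K tay lip sol a01.
have nR0 : (0 : R) < n%:R by rewrite ltr0n.
have crate : K * (10 * a + 42 * M ^+ 6 * stein_rate w n N / a) @[N --> \oo] -->
   K * (10 * a + 42 * M ^+ 6 *
    (n%:R^-1 + (vn lam rho)^-1 + Lw lam rho ^+ 2 / (n%:R ^+ 2 * vn lam rho)) / a).
  apply: cvgM; first exact: cvg_cst.
  apply: cvgD; first exact: cvg_cst.
  apply: cvgM; last exact: cvg_cst.
  apply: cvgM; first exact: cvg_cst.
  rewrite /stein_rate; apply: cvgD.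
    apply: cvgD; first exact: cvg_cst.
    by apply: cvgV; [rewrite gt_eqF|].
  apply: cvgM; first by apply: cvgM.
  apply: cvgV; first by rewrite gt_eqF// mulr_gt0// exprn_gt0.
  by apply: cvgM => //; exact: cvg_cst.
apply: (ler_cvg_to (cvg_norm (ex_statN_cvg cpsi psiK)) crate).
near=> N.
have cv : ((Num.sqrt (vsum w N))^-1 / n%:R) ^+ 2 * (n%:R ^+ 2 * vsum w N) = 1 by near: N.
have c0 : 0 <= (Num.sqrt (vsum w N))^-1 / n%:R.
  by rewrite divr_ge0 ?invr_ge0 ?sqrtr_ge0.
have bW := bmeas_statN N.
have bfW : bmeas (fun om => f (statN N om)) := bmeas_comp mf fK (proj1 bW).
have bf'W : bmeas (fun om => f' (statN N om)) := bmeas_comp mf' f'K (proj1 bW).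
have := stein_bound XI w01 mphi M1 phiM phi0 phi_orth mf mf' fK f'K tay lip c0 n0 cv a01.
rewrite distrC; congr (`|_| <= _).
transitivity (2 * E (fun om => f' (statN N om)) - E (fun om => statN N om * f (statN N om))).
  by [].
rewrite -exZ; last by bm.
rewrite -exB; [|by bm|by bm].
by apply: ex_ext => om; rewrite sol.
Unshelve. all: by end_near. Qed.

End statistic.

(** * Convergence in distribution of the normalised statistic *)

Unset Implicit Arguments. Set Strict Implicit. Set Printing Implicit Defensive.

Theorem theorem2 (R : realType) (d : measure_display) (T : measurableType d)
  (P0 : probability T R) (lam : nat -> R) (phi : nat -> T -> R) (s : R)
  (dO : measure_display) (Omega : measurableType dO) (P : probability Omega R)
  (X : nat -> Omega -> T) (rho : nat -> R) :
  (* eigenvalues lambda_1 > lambda_2 > ... > 0 (lam k stands for lambda_{k+1}) *)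
  (forall k, 0 < lam k) -> (forall k, lam k.+1 < lam k) ->
  (* 0 < liminf k^{2s} lambda_k <= limsup k^{2s} lambda_k < oo, s > 1/2 *)
  1 / 2 < s ->
  (0 < limn_einf (fun k => ((k.+1)%:R `^ (2 * s) * lam k)%:E))%E ->
  (limn_esup (fun k => ((k.+1)%:R `^ (2 * s) * lam k)%:E) < +oo)%E ->
  (* orthonormal basis of mean-zero L2(P0), sup_k ||phi_k||_oo < oo *)
  onb_mean_zero P0 phi ->
  (exists M : R, forall k x, `|phi k x| <= M) ->
  (* rho_n > 0, rho_n -> 0, n rho_n^{1/(2s)} -> oo *)
  (forall n, 0 < rho n) ->
  rho @ \oo --> 0 ->
  (fun n => n%:R * rho n `^ (2 * s)^-1) @ \oo --> +oo ->
  (* X_1, X_2, ... i.i.d. from P0 *)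
  iid P P0 X ->
  (* convergence in distribution to N(0,2) (continuous limit cdf) *)
  forall t : R,
    (fun n => fine (P [set w | (Num.sqrt (vn lam (rho n)))^-1 *
                      (n%:R * eta2 lam phi (rho n) n (fun i => X i w)
                       - An lam phi (rho n) n (fun i => X i w)) <= t]))
      @ \oo --> fine (normal_prob 0 (Num.sqrt 2) `]-oo, t]).
Proof.
move=> lam0 _ s12 linf lsup [mphi _ phi0E phi_orthE _] [M' phiM'] rho0 rho_cvg nrho XI t.
(* A bound of at least 1 lets all powers of [M] be absorbed into [M^6]. *)
pose M := Num.max 1 M'.
have M1 : 1 <= M by rewrite le_max lexx.
have phiM k x : `|phi k x| <= M by rewrite le_max phiM' orbT.
have phi0 k : \int[P0]_x phi k x = 0 by rewrite /Rintegral phi0E.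
have phi_orth j k : \int[P0]_x (phi j x * phi k x) = (j == k)%:R.
  by rewrite /Rintegral phi_orthE.
have a0 k : 0 < k.+1%:R `^ (2 * s) * lam k by rewrite mulr_gt0// powR_gt0.
have [c1 c10 lam_lb] := limn_einf_gt0_lb a0 linf.
have [c2 lam_ub] := limn_esup_lty_ub lsup.
have w01 n k := mweight_01 lam0 k (rho0 n).
have cw n := is_cvg_sum_mweight lam0 s12 c10 lam_lb lam_ub (rho0 n).
have cw2 n := is_cvg_sum_mweight_sqr lam0 s12 c10 lam_lb lam_ub (rho0 n).
have v0 n := vn_gt0 lam0 s12 c10 lam_lb lam_ub (rho0 n).
have rate := clt_rate_cvg0 lam0 s12 c10 lam_lb lam_ub rho0 rho_cvg nrho.
(* The shift discards [n = 0], for which the normalisation by [n] is degenerate. *)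
rewrite -cvg_shiftS.
apply: (@cdf_cvg _ _ _ P (fun n => stat X phi lam (rho n.+1) n.+1)).
- by move=> n; apply: (measurable_stat M1 phiM (w01 _) (cw _) (cw2 _) (v0 _) _ XI mphi).
- move=> psi B L B0 lip supp int0.
  have [f [f' [K [[mf mf'] [fK f'K] tay lip' sol]]]] := stein_solution B0 lip supp int0.
  have L0 : 0 <= L by have := lip 0 1; rewrite subr0 normr1 mulr1; exact: le_trans.
  have K0 : 0 <= K by exact: le_trans (fK 0).
  have psiK := lip_supp_bound B0 lip supp.
  have cpsi := lip_continuous L0 lip.
  have M6 : 0 <= 42 * M ^+ 6 by rewrite mulr_ge0// exprn_ge0// (le_trans _ M1).
  apply/cvgrPdist_le => e e0.
  (* Fixed before [n], so that the rate divided by [a] still tends to zero. It makes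
     [10 K a <= e/2], and the threshold [b] below makes the other term at most [e/2]; the added ones
     keep the denominators positive. *)
  pose a : R := Num.min 1 (e / (20 * (K + 1))).
  have K10 : 0 < 20 * (K + 1) by rewrite mulr_gt0// ltr_wpDl.
  have a0' : 0 < a by rewrite lt_min ltr01 divr_gt0.
  have a1 : 0 < a <= 1 by rewrite a0' ge_min lexx.
  pose b := a * (e / 2) / ((K + 1) * (42 * M ^+ 6 + 1)).
  have b0 : 0 < b.
    by rewrite divr_gt0// ?mulr_gt0// ?divr_gt0// ltr_wpDl.
  move: rate; rewrite -cvg_shiftS => rate1.
  near=> n; rewrite sub0r normrN.
  have rb : n.+1%:R^-1 + (vn lam (rho n.+1))^-1 +
      Lw lam (rho n.+1) ^+ 2 / (n.+1%:R ^+ 2 * vn lam (rho n.+1)) < b.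
    by near: n; exact: (cvgr_lt _ rate1 _ b0).
  apply: le_trans (stat_stein M1 phiM (w01 _) (cw _) (cw2 _) (v0 _) (ltn0Sn n) XI mphi
    phi0 phi_orth cpsi psiK mf mf' fK f'K tay lip' sol a1) _.
  move: (_ + _ + _) rb => r rb.
  have Ka : K * (10 * a) <= e / 2.
    apply: (@le_trans _ _ ((K + 1) * (10 * (e / (20 * (K + 1)))))).
      apply: ler_pM => //; [by rewrite mulr_ge0// ltW|by rewrite lerDl|].
      by rewrite ler_wpM2l// ge_min lexx orbT.
    by rewrite le_eqVlt; apply/orP; left; apply/eqP; field; rewrite gt_eqF// ltr_wpDl.
  have Kb : K * (42 * M ^+ 6 * r / a) <= e / 2.
    have M61 : 0 < 42 * M ^+ 6 + 1 by rewrite ltr_wpDl.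
    have Kp : 0 < K + 1 by rewrite ltr_wpDl.
    apply: (@le_trans _ _ ((K + 1) * ((42 * M ^+ 6 + 1) * b / a))); last first.
      rewrite /b le_eqVlt; apply/orP; left; apply/eqP.
      by field; rewrite !gt_eqF.
    apply: (@le_trans _ _ (K * ((42 * M ^+ 6 + 1) * b / a))).
      rewrite ler_wpM2l// ler_wpM2r ?invr_ge0 ?(ltW a0')//.
      apply: (@le_trans _ _ (42 * M ^+ 6 * b)); first by rewrite ler_wpM2l// ltW.
      by rewrite ler_wpM2r ?(ltW b0)// lerDl.
    by rewrite ler_wpM2r ?lerDl// divr_ge0 ?(ltW a0')// mulr_ge0 ?(ltW b0) ?(ltW M61).
  by rewrite mulrDr; lra.
- move=> chi B cchi chi01 B0 chiB; apply: nearW => n.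
  exact: (stat_tight M1 phiM (w01 _) (cw _) (cw2 _) (v0 _) _ XI mphi phi0 phi_orth).
Unshelve. all: by end_near. Qed.
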